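(* Let $0<\alpha<1$, $\theta>0$, $0<p<1$, $q=1-p$. For $0<\beta<1$, set $R\overset{d}{=}c^\alpha X_\beta$, where $c=(p/q)^{1/\alpha}$; this means that $\Lambda_{\alpha,H}=\Lambda_{\alpha\beta,p}$. Now define $p_\alpha=p^\alpha/(p^\alpha+q^\alpha)$. Then $\xi_\theta\overset{d}{=}A^{(\beta,\theta)}_{\beta,p_\alpha}\overset{d}{=}M_\theta(\Lambda_{\beta,p_\alpha})$, and for this choice $$A^{(\alpha,\alpha\theta)}_{\alpha,\xi_\theta}\overset{d}{=}A^{(\alpha\beta,\alpha\theta)}_{\alpha\beta,p}\overset{d}{=}M_{\alpha\theta}(\Lambda_{\alpha\beta,p})\overset{d}{=}P_{\alpha\beta,\alpha\theta}(C).$$ Results recovering $p$-skew Bessel bridges follow as special cases, with the choice of $\theta=\beta$ and $\theta=1$ respectively: (i) $A^{(\alpha,\alpha\beta)}_{\alpha,\xi_\beta}\overset{d}{=}A^{(\alpha\beta,\alpha\beta)}_{\alpha\beta,p}$; (ii) $A^{(\alpha,\alpha)}_{\alpha,\xi_1}\overset{d}{=}A^{(\alpha\beta,\alpha)}_{\alpha\beta,p}$.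
   Context: For $0<\gamma<1$, $X_\gamma\overset{d}{=}S_\gamma/S'_\gamma$ with $S_\gamma,S'_\gamma$ independent positive $\gamma$-stable variables, $\mathbb{E}[e^{-\lambda S_\gamma}]=e^{-\lambda^\gamma}$. For $0<u<1$, $\Lambda_{\gamma,u}$ is the law of $\frac{(u/(1-u))^{1/\gamma}X_\gamma}{1+(u/(1-u))^{1/\gamma}X_\gamma}$ (time spent positive up to time 1 by a $u$-skew Bessel process of dimension $2-2\gamma$). For a probability $K$ on $[0,\infty)$ with $\int\log(1+x)K(dx)<\infty$ and $\tau>0$, $M_\tau(K)$ is the mean of a Dirichlet process with shape $\tau K$, characterized by $\mathbb{E}[(1+\lambda M_\tau(K))^{-\tau}]=\exp(-\tau\int\log(1+\lambda x)K(dx))$. For $\tau>0$, $A^{(\gamma,\tau)}_{\gamma,u}$ is the time spent positive up to time 1 by a $u$-skewed generalized Bessel bridge (a $u$-skew Bessel bridge of dimension $2-2\gamma$ when $\tau=\gamma$); it has the law of $P_{\gamma,\tau}(C)$, the mass that a two-parameter PD$(\gamma,\tau)$ random probability measure $P_{\gamma,\tau}$ gives to a set $C$ with $\mathbb{E}[P_{\gamma,\tau}(C)]=u$, a law on $[0,1]$ characterized by $\mathbb{E}[(1+\lambda P_{\gamma,\tau}(C))^{-\tau}]=(1-u+u(1+\lambda)^\gamma)^{-\tau/\gamma}$, $\lambda>0$. In the claim, $C$ is such that $\mathbb{E}[P_{\alpha\beta,\alpha\theta}(C)]=p$. $A^{(\gamma,\tau)}_{\gamma,\xi}$, for a $[0,1]$-valued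 $\xi$, has conditionally on $\xi=u$ the law of $A^{(\gamma,\tau)}_{\gamma,u}$. With $R$ as in the claim, $H$ its law, and $R$ independent of $X_\alpha$: $\Lambda_{\alpha,H}$ is the law of $R^{1/\alpha}X_\alpha/(R^{1/\alpha}X_\alpha+1)$, and $\xi_\theta$ is the $[0,1]$-valued variable distributed as $M_\theta(K)$ with $K$ the law of $R/(R+1)=c^\alpha X_\beta/(c^\alpha X_\beta+1)$ (equivalently, its law is proportional to $(1-u)^\theta\tilde Q(du)$, with $\tilde Q$ the law of $M_\theta(H)/(M_\theta(H)+1)$).
   Formalization: The claim as printed is inconsistent unless p=1/2 (comparing means gives p_α=p); the formal version takes c=(p/q)^{1/(αβ)} instead of (p/q)^{1/α}, and p instead of p_α in ξ_θ = A^{(β,θ)}_{β,p_α} = M_θ(Λ_{β,p_α}). *)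

(* Defs.v *)
From HB Require Import structures.
From mathcomp Require Import all_boot all_order all_algebra.
From mathcomp Require Import all_classical all_reals all_analysis.

Set Implicit Arguments.
Unset Strict Implicit.
Unset Printing Implicit Defensive.

Import Order.TTheory GRing.Theory Num.Theory.

Local Open Scope classical_set_scope.
Local Open Scope ring_scope.
Local Open Scope ereal_scope.

(* Random variables enter only through their laws, which are Borel probability
   measures on the line; [same_law] is equality in distribution, and
   [image_law P f mu] says that mu is the law of the random variable f
   defined on the probability space (T, P). *)
Notation law R := (probability (measurableTypeR R) R).

Definition same_law (R : realType) (mu nu : law R) : Prop :=
  forall B : set (measurableTypeR R), measurable B -> mu B = nu B.

Definition image_law (R : realType) (d : measure_display)
    (T : measurableType d) (P : {measure set T -> \bar R})
    (f : T -> measurableTypeR R) (mu : law R) : Prop :=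
  measurable_fun setT f /\
  forall B : set (measurableTypeR R), measurable B -> mu B = pushforward P f B.

Definition stable_law (R : realType) (gamma : R) (sigma : law R) : Prop :=
  sigma `]0%R, +oo[%classic = 1 /\
  forall lambda : R, (0 < lambda)%R ->
    \int[sigma]_s (expR (- (lambda * s)))%:E = (expR (- (lambda `^ gamma)))%:E.

(* Law of X_gamma = S_gamma / S'_gamma; the product measure makes S_gamma and
   S'_gamma independent. *)
Definition X_law (R : realType) (gamma : R) (mu : law R) : Prop :=
  exists2 sigma : law R, stable_law gamma sigma &
    image_law (sigma \x sigma) (fun s : R * R => s.1 / s.2)%R mu.

(* Lambda_{gamma,u} *)
Definition Lambda_law (R : realType) (gamma u : R) (mu : law R) : Prop :=
  exists2 X : law R, X_law gamma X &
    let a := ((u / (1 - u)) `^ gamma^-1)%R in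
    image_law X (fun x : R => a * x / (1 + a * x))%R mu.

(* Lambda_{alpha,H}, the law of R^{1/alpha} X_alpha / (R^{1/alpha} X_alpha + 1)
   with R of law H independent of X_alpha *)
Definition Lambda_mixed_law (R : realType) (alpha : R) (H mu : law R) : Prop :=
  exists2 X : law R, X_law alpha X &
    image_law (H \x X)
      (fun z : R * R =>
         (z.1 `^ alpha^-1 * z.2) / (z.1 `^ alpha^-1 * z.2 + 1))%R mu.

(* [dirichlet_mean_law tau K mu]: mu is the law of M_tau(K), the mean of a
   Dirichlet process with shape tau K, given through its generalized
   Cauchy-Stieltjes transform of order tau (Cifarelli-Regazzini), which
   determines a law on the half-line. *)
Definition dirichlet_mean_law (R : realType) (tau : R) (K mu : law R) : Prop :=
  [/\ K `[0%R, +oo[%classic = 1,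
      \int[K]_x (ln (1 + x))%:E < +oo,
      mu `[0%R, +oo[%classic = 1
    & forall lambda : R, (0 < lambda)%R ->
      \int[mu]_x ((1 + lambda * x) `^ (- tau))%:E =
      expeR (- (tau%:E * \int[K]_x (ln (1 + lambda * x))%:E))].

(* Transform at lambda of the mass that a PD(gamma,tau) random probability
   measure gives to a set of mean mass u *)
Definition PD_transform (R : realType) (gamma tau u lambda : R) : R :=
  ((1 - u + u * (1 + lambda) `^ gamma) `^ (- (tau / gamma)))%R.

(* [bridge_law gamma tau u mu]: mu is the law of A^{(gamma,tau)}_{gamma,u}, the
   time spent positive up to time 1 by a u-skewed generalized Bessel bridge (a
   genuine u-skew Bessel bridge of dimension 2 - 2 gamma if tau = gamma).  It
   is the law on [0,1] with this transform of order tau. *)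
Definition bridge_law (R : realType) (gamma tau u : R) (mu : law R) : Prop :=
  mu `[0%R, 1%R]%classic = 1 /\
  forall lambda : R, (0 < lambda)%R ->
    \int[mu]_x ((1 + lambda * x) `^ (- tau))%:E =
    (PD_transform gamma tau u lambda)%:E.

(* Law of A^{(gamma,tau)}_{gamma,xi} with xi a [0,1]-valued variable of law
   [xi]: kappa is a regular conditional law given xi.  Its values outside
   [0,1] are irrelevant. *)
Definition mixed_bridge_law (R : realType) (gamma tau : R) (xi mu : law R) :
    Prop :=
  exists2 kappa : R.-pker (measurableTypeR R) ~> (measurableTypeR R),
    (forall u : R, (0 <= u <= 1)%R ->
       exists2 nu : law R, bridge_law gamma tau u nu &
         forall B : set (measurableTypeR R), measurable B -> kappa u B = nu B) &
    forall B : set (measurableTypeR R), measurable B ->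
      mu B = \int[xi]_u kappa u B.

(* A random probability measure on S is a probability kernel from the
   underlying probability space (T, P) to S. *)
Definition random_mass (R : realType) (d d' : measure_display)
    (T : measurableType d) (S : measurableType d')
    (Pr : R.-pker T ~> S) (C : set S) (w : T) : measurableTypeR R :=
  fine (Pr w C).

(* The masses of a PD(gamma,tau) random probability measure: for every
   measurable C, with u the mean of Pr(C), Pr(C) has the transform above. *)
Definition PD_random_measure (R : realType) (d d' : measure_display)
    (T : measurableType d) (P : probability T R) (S : measurableType d')
    (gamma tau : R) (Pr : R.-pker T ~> S) : Prop :=
  forall (C : set S) (u : R), measurable C ->
    \int[P]_w Pr w C = u%:E ->
    forall lambda : R, (0 < lambda)%R ->
      \int[P]_w ((1 + lambda * random_mass Pr C w) `^ (- tau))%:E =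
      (PD_transform gamma tau u lambda)%:E.

(* Law of xi_theta *)
Definition xi_law (R : realType) (theta : R) (K xi : law R) : Prop :=
  xi `[0%R, 1%R]%classic = 1 /\ dirichlet_mean_law theta K xi.

(* Main.v *)
(* All the laws are identified through transforms.

   Uniqueness: suppose [w z^k] has the same integral under mu and nu for all k,
   with z >= 0 bounded.  As exp (- (z/a)^(n^2) / n) is a bounded limit of
   polynomials in z and tends to the indicator of {z <= a}, so has
   [w 1_{z <= a}].  Taking z = exp(-x) gives uniqueness for Laplace transforms.
   For the transform of order tau, differentiation in l gives the integrals of
   x^k (1 + l x)^(- tau - k), hence the above with w = (1 + l x)^(- tau) and
   z = l x / (1 + l x); then l tends to 0.

   Logarithmic moments: S' + s S has the law of (1 + s^gamma)^(1/gamma) S', so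
   that E ln (1 + s S/S') = E (ln (S' + s S) - ln S') is the logarithm of the
   scaling factor; this is made rigorous without integrability of ln S by
   truncating ln.  Hence Lambda_{gamma,p} has log-transform
   gamma^-1 ln (1 - p + p (1 + l)^gamma), and the Dirichlet mean transform is
   the PD transform.

   The chain: conditionally on xi = u the transform of order alpha theta at l is
   (1 + m u)^(- theta) with m = (1 + l)^alpha - 1, i.e. the transform of order
   theta of xi at m, which is known.

   Lambda_{alpha,H}: S_beta^(1/alpha) S_alpha is stable of index alpha beta,
   hence X_beta^(1/alpha) X_alpha has the law of X_{alpha beta}. *)
Require Import Defs.
From HB Require Import structures.
From mathcomp Require Import all_boot all_order all_algebra.
From mathcomp Require Import all_classical all_reals all_analysis.
From mathcomp Require Import measurable_realfun ring lra.
Set Implicit Arguments.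
Unset Strict Implicit.
Unset Printing Implicit Defensive.
Import Order.TTheory GRing.Theory Num.Theory.
Import numFieldNormedType.Exports.
Local Open Scope classical_set_scope.
Local Open Scope ring_scope.

(** * Functions with equal integrals under two laws *)

Section same_integral.
Context d (T : measurableType d) (R : realType).
Variables (mu nu : probability T R) (D : set T).
Hypothesis mD : measurable D.

(** Measurability and boundedness travel with the equality, so that the class is closed under linear
    combinations and bounded limits without further side conditions. Everything is relative to a set
    [D], since the functions of interest are bounded only where the laws live. *)
Definition same_int (f : T -> R) : Prop :=
  [/\ measurable_fun D f, (exists M, forall x, D x -> `|f x| <= M) &
      (\int[mu]_(x in D) (f x)%:E = \int[nu]_(x in D) (f x)%:E)%E].

Lemma bounded_integrable (P : probability T R) (f : T -> R) (M : R) :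
  measurable_fun D f -> (forall x, D x -> `|f x| <= M) ->
  P.-integrable D (EFin \o f).
Proof.
move=> mf fM; apply: measurable_bounded_integrable => //.
  by rewrite (le_lt_trans (probability_le1 _ mD)) ?ltry.
by exists M; split=> [|N MN x Dx]; [exact: num_real|exact: le_trans (fM x Dx) (ltW MN)].
Qed.

Lemma same_int_eq (f g : T -> R) :
  (forall x, D x -> f x = g x) -> same_int f -> same_int g.
Proof.
move=> fg [mf [M fM] fE]; split.
- by apply: eq_measurable_fun mf => x /[!inE]; exact: fg.
- by exists M => x Dx; rewrite -fg// fM.
- have e (P : probability T R) :
      (\int[P]_(x in D) (g x)%:E = \int[P]_(x in D) (f x)%:E)%E.
    by apply: eq_integral => x /[!inE] /fg ->.
  by rewrite !e.
Qed.

Lemma same_intD (f g : T -> R) :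
  same_int f -> same_int g -> same_int (fun x => f x + g x).
Proof.
move=> [mf [M fM] fE] [mg [N gN] gE]; split.
- exact: measurable_funD.
- by exists (M + N) => x Dx; rewrite (le_trans (ler_normD _ _))// lerD ?fM ?gN.
- under eq_integral do rewrite EFinD.
  under [RHS]eq_integral do rewrite EFinD.
  rewrite !integralD//; try exact: bounded_integrable.
  all: try exact: (bounded_integrable _ mf fM).
  all: try exact: (bounded_integrable _ mg gN).
  by rewrite fE gE.
Qed.

Lemma same_intZ (c : R) (f : T -> R) :
  same_int f -> same_int (fun x => c * f x).
Proof.
move=> [mf [M fM] fE]; split.
- exact: measurable_funM.
- by exists (`|c| * M) => x Dx; rewrite normrM ler_wpM2l ?fM.
- under eq_integral do rewrite EFinM.
  under [RHS]eq_integral do rewrite EFinM.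
  rewrite !integralZl//; try exact: (bounded_integrable _ mf fM).
  by rewrite fE.
Qed.

Lemma same_int_sum (f : nat -> T -> R) (n : nat) :
  (forall k, same_int (f k)) -> same_int (fun x => \sum_(0 <= k < n) f k x).
Proof.
move=> fE; elim: n => [|n IH].
  apply: (@same_int_eq (fun x => 0 * f 0%N x)); last exact: same_intZ.
  by move=> x _; rewrite big_geq// mul0r.
apply: same_int_eq (same_intD IH (fE n)) => x _.
by rewrite big_nat_recr.
Qed.

(** Dominated convergence under each law, with the constant [M] as dominating function; constants
    are integrable for a probability. *)
Lemma same_int_lim (f_ : nat -> T -> R) (f : T -> R) (M : R) :
  (forall n, same_int (f_ n)) -> (forall n x, D x -> `|f_ n x| <= M) ->
  (forall x, D x -> f_ ^~ x @ \oo --> f x) -> same_int f.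
Proof.
move=> fE fM f_f.
have mf : measurable_fun D f.
  by apply: (measurable_fun_cvg _ f_f) => n; have [] := fE n.
have bf x : D x -> `|f x| <= M.
  move=> Dx; have cf : `|f_ n x| @[n --> \oo] --> `|f x| by exact: cvg_norm (f_f x Dx).
  rewrite -(cvg_lim (@Rhausdorff R) cf).
  apply: limr_le; first by apply/cvg_ex; exists `|f x|.
  by near=> n; exact: fM.
have cvgI (P : probability T R) :
    (\int[P]_(x in D) (f_ n x)%:E)%E @[n --> \oo] --> (\int[P]_(x in D) (f x)%:E)%E.
  have [] := @dominated_convergence _ T R P D mD (fun n x => (f_ n x)%:E)
    (EFin \o f) (cst M%:E).
  - by move=> n; apply/measurable_EFinP; have [] := fE n.
  - exact/measurable_EFinP.
  - by apply: aeW => x Dx; apply: cvg_EFin; [exact: nearW|exact: f_f].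
  - exact: finite_measure_integrable_cst.
  - by apply: aeW => x n Dx; rewrite lee_fin; exact: fM.
  by [].
split => //; first by exists M.
rewrite -(cvg_lim _ (cvgI mu))// -(cvg_lim _ (cvgI nu))//.
by congr (limn _); apply/funext => n; have [] := fE n.
Unshelve. all: by end_near. Qed.

End same_integral.

(** * Moments determine a law *)

(** Put N = n + 1. If z <= a, the quantity (z/a)^(N^2) / N is at most 1/N; the factor 1/N gives the
    limit 1 even at z = a. If z > a, Bernoulli's inequality makes it at least N (z/a - 1), which
    tends to infinity; this is where the square in the exponent is used. *)
Lemma smoothed_indicator_cvg (R : realType) (a z : R) : 0 < a -> 0 <= z ->
  expR (- (n.+1%:R^-1 * (z / a) ^+ (n.+1 * n.+1))) @[n --> \oo] -->
  ((z <= a)%R%:R : R).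
Proof.
move=> a0 z0; have [za|az] := leP z a.
- apply: (@squeeze_cvgr _ _ _ _ (fun n => 1 - harmonic n) (fun=> 1)).
  + apply: nearW => n.
    have y0 : 0 <= n.+1%:R^-1 * (z / a) ^+ (n.+1 * n.+1).
      by rewrite mulr_ge0// exprn_ge0// divr_ge0// ltW.
    have y1 : n.+1%:R^-1 * (z / a) ^+ (n.+1 * n.+1) <= harmonic n.
      rewrite ler_piMr// exprn_ile1//; first by rewrite divr_ge0// ltW.
      by rewrite ler_pdivrMr// mul1r.
    apply/andP; split; last by rewrite -[leRHS]expR0 ler_expR oppr_le0.
    by apply: le_trans (expR_ge1Dx _); rewrite lerD2l lerN2.
  + rewrite -[X in _ --> X]subr0; apply: cvgB; [exact: cvg_cst|exact: cvg_harmonic].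
  + exact: cvg_cst.
- pose dl := z / a - 1.
  have dl0 : 0 < dl by rewrite subr_gt0 ltr_pdivlMr// mul1r.
  apply: (@squeeze_cvgr _ _ _ _ (fun=> 0) (fun n => dl^-1 * harmonic n)).
  (* From 1 + e <= exp e, the value exp (- e) is at most 1/e, and e is at least N [dl] by
     Bernoulli. *)
  + apply: nearW => n; rewrite expR_ge0/= expRN.
    rewrite -invfM lef_pV2 ?posrE ?expR_gt0 ?mulr_gt0//.
    apply: le_trans (expR_ge1Dx _); rewrite ler_wpDl//.
    have bern k : 1 + k%:R * dl <= (z / a) ^+ k.
      elim: k => [|k IH]; first by rewrite mul0r addr0 expr0.
      have zE : z / a = 1 + dl by rewrite /dl addrC subrK.
      rewrite exprS {1}zE.
      apply: (@le_trans _ _ ((1 + dl) * (1 + k%:R * dl))); last first.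
        by rewrite ler_wpM2l// addr_ge0// ltW.
      have : 0 <= k%:R * dl * dl by rewrite !mulr_ge0 ?(ltW dl0).
      by rewrite -natr1; lra.
    apply: (@le_trans _ _ (n.+1%:R^-1 * (1 + (n.+1 * n.+1)%:R * dl))); last first.
      by rewrite ler_wpM2l.
    rewrite natrM mulrDr -!mulrA mulKf ?pnatr_eq0// (mulrC dl) ler_wpDl//.
  + exact: cvg_cst.
  + rewrite -[X in _ --> X](mulr0 dl^-1).
    by apply: cvgMr; exact: cvg_harmonic.
Qed.

(** Termwise, the partial sum at [y] is dominated by the one at [Y], and the latter increases to
    [expR Y]. The bound is uniform in [n], as dominated convergence requires. *)
Lemma series_exp_coeff_bound (R : realType) (y Y : R) (n : nat) : `|y| <= Y ->
  `|series (exp_coeff y) n| <= expR Y.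
Proof.
move=> yY; rewrite /series/=.
apply: le_trans (ler_norm_sum _ _ _) _.
apply: (@le_trans _ _ (series (exp_coeff Y) n)).
  apply: ler_sum => i _; rewrite /exp_coeff normrM normrX normfV.
  rewrite (ger0_norm (ler0n _ _)) ler_wpM2r ?invr_ge0//.
  by rewrite lerXn2r// nnegrE// (le_trans _ yY).
have Y0 : 0 <= Y by rewrite (le_trans _ yY).
rewrite /expR; apply: nondecreasing_cvgn_le; last exact: is_cvg_series_exp_coeff.
apply/nondecreasing_seqP => k; rewrite /series/= big_nat_recr//= lerDl.
exact: exp_coeff_ge0.
Qed.

Section moments.
Context d (T : measurableType d) (R : realType).
Variables (mu nu : probability T R) (D : set T).
Hypothesis mD : measurable D.

(** The partial sums of the exponential series are polynomials in [y], bounded by [W * expR Y] after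
    multiplication by [w]. *)
Lemma same_int_expR (w y : T -> R) (W Y : R) :
  (forall x, D x -> `|w x| <= W) -> (forall x, D x -> `|y x| <= Y) ->
  (forall k, same_int mu nu D (fun x => w x * y x ^+ k)) ->
  same_int mu nu D (fun x => w x * expR (y x)).
Proof.
move=> wW yY H.
apply: (@same_int_lim _ _ _ mu nu D mD
  (fun n x => w x * series (exp_coeff (y x)) n) _ (W * expR Y)).
- move=> n.
  have Hk k : same_int mu nu D (fun x => k`!%:R^-1 * (w x * y x ^+ k)).
    exact: same_intZ.
  apply: same_int_eq (same_int_sum mD n Hk) => x Dx.
  rewrite /series/= mulr_sumr; apply: eq_bigr => k _.
  by rewrite /exp_coeff mulrCA [_^-1 * _]mulrC.
- move=> n x Dx; rewrite normrM ler_pM ?wW//.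
  by apply: series_exp_coeff_bound; exact: yY.
- move=> x Dx; apply: cvgMr; exact: is_cvg_series_exp_coeff.
Qed.

Lemma same_int_le (w z : T -> R) (Z a : R) : 0 < a ->
  (forall x, D x -> 0 <= z x <= Z) ->
  (forall k, same_int mu nu D (fun x => w x * z x ^+ k)) ->
  same_int mu nu D (fun x => w x * (z x <= a)%R%:R).
Proof.
move=> a0 zZ H.
have [_ [W wW] _] : same_int mu nu D w.
  by apply: same_int_eq (H 0%N) => x _; rewrite expr0 mulr1.
pose y n x := - (n.+1%:R^-1 * (z x / a) ^+ (n.+1 * n.+1)).
apply: (@same_int_lim _ _ _ mu nu D mD (fun n x => w x * expR (y n x)) _ W).
- move=> n; pose m := (n.+1 * n.+1)%N.
  apply: (@same_int_expR _ _ W (n.+1%:R^-1 * (Z / a) ^+ m)) => //.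
    move=> x Dx; have /andP[z0 z1] := zZ x Dx.
    rewrite normrN ger0_norm; last by rewrite mulr_ge0// exprn_ge0// divr_ge0// ltW.
    have a0' := ltW a0; have Z0 := le_trans z0 z1.
    by rewrite ler_wpM2l// lerXn2r ?nnegrE ?divr_ge0// ler_pM2r ?invr_gt0.
  (* The k-th power of [y n] is a constant multiple of the power [m * k] of [z], so the moment
     hypothesis covers it. *)
  move=> k; have := same_intZ mD ((- (n.+1%:R^-1 * a^-1 ^+ m)) ^+ k) (H (m * k)%N).
  apply: same_int_eq => x _.
  by rewrite mulrCA; congr (_ * _); rewrite exprM -exprMn; congr (_ ^+ _);
    rewrite /y -/m exprMn mulNr mulrAC -!mulrA.
- move=> n x Dx; have /andP[z0 _] := zZ x Dx.
  rewrite normrM -[leRHS]mulr1 ler_pM ?wW//.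
  rewrite ger0_norm ?expR_ge0// -expR0 ler_expR oppr_le0.
  by rewrite mulr_ge0// exprn_ge0// divr_ge0// ltW.
- move=> x Dx; have /andP[z0 _] := zZ x Dx.
  by apply: cvgMr; exact: smoothed_indicator_cvg.
Qed.

Lemma same_int_measure (A : set T) : measurable A -> A `<=` D ->
  same_int mu nu D (\1_A : T -> R) -> mu A = nu A.
Proof.
move=> mA AD [_ _].
by rewrite !integral_indic// !(setIidl AD).
Qed.

End moments.

(** Upper half-lines are stable under intersection, generate the Borel sets and exhaust the line.
    The open version suits the Stieltjes transform, where {x <= t} is obtained and complemented; the
    closed version below suits the Laplace transform, where exp (- x) <= exp (- t) means t <= x. *)
Lemma same_law_itvoy (R : realType) (mu nu : law R) :
  (forall t : R, mu `]t, +oo[%classic = nu `]t, +oo[%classic) ->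
  same_law mu nu.
Proof.
move=> H B; apply: (@measure_unique _ R (measurableTypeR R) (@RGenOInfty.G R)
  (fun k => `](- k%:R), +oo[%classic)).
- exact: RGenOInfty.measurableE.
- move=> _ _ [x ->] [y ->]; exists (Num.max x y); apply/seteqP; split=> z /=;
    rewrite !in_itv/= !andbT gt_max; first by move=> [-> ->].
  by move=> /andP[].
- by move=> k; exists (- k%:R).
- apply/seteqP; split=> // x _; exists (Num.trunc `|x|).+1 => //=.
  rewrite in_itv/= andbT ltrNl.
  apply: le_lt_trans (truncnS_gt _); first by rewrite -normrN ler_norm.
- by move=> _ [x ->]; exact: H.
- move=> k; apply: le_lt_trans (probability_le1 _ _) _; rewrite ?ltry//.
Qed.

Lemma same_law_itvcy (R : realType) (mu nu : law R) :
  (forall t : R, mu `[t, +oo[%classic = nu `[t, +oo[%classic) ->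
  same_law mu nu.
Proof.
move=> H B; apply: (@measure_unique _ R (measurableTypeR R) (@RGenCInfty.G R)
  (fun k => `[(- k%:R), +oo[%classic)).
- exact: RGenCInfty.measurableE.
- move=> _ _ [x ->] [y ->]; exists (Num.max x y); apply/seteqP; split=> z /=;
    rewrite !in_itv/= !andbT ge_max; first by move=> [-> ->].
  by move=> /andP[].
- by move=> k; exists (- k%:R).
- apply/seteqP; split=> // x _; exists (Num.trunc `|x|).+1 => //=.
  rewrite in_itv/= andbT lerNl ltW//.
  apply: le_lt_trans (truncnS_gt _); first by rewrite -normrN ler_norm.
- by move=> _ [x ->]; exact: H.
- move=> k; apply: le_lt_trans (probability_le1 _ _) _; rewrite ?ltry//.
Qed.

(** * Uniqueness for Laplace and generalized Stieltjes transforms *)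

Lemma integral_conull d (T : measurableType d) (R : realType)
    (P : probability T R) (D : set T) (f : T -> \bar R) :
  measurable D -> P D = 1%E -> measurable_fun setT f ->
  (forall x, 0 <= f x)%E -> (\int[P]_x f x = \int[P]_(x in D) f x)%E.
Proof.
move=> mD PD mf f0.
rewrite (@ge0_negligible_integral _ _ _ _ _ (~` D))//; first by rewrite setTD setCK.
- exact: measurableC.
- by have := probability_setC P mD; rewrite PD subee.
Qed.

Lemma same_int_conull d (T : measurableType d) (R : realType)
    (mu nu : probability T R) (D : set T) (f : T -> R) (M : R) :
  measurable D -> mu D = 1%E -> nu D = 1%E -> measurable_fun setT f ->
  (forall x, 0 <= f x) -> (forall x, D x -> f x <= M) ->
  (\int[mu]_x (f x)%:E = \int[nu]_x (f x)%:E)%E -> same_int mu nu D f.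
Proof.
move=> mD muD nuD mf f0 fM fE; split; first exact: measurable_funTS.
- by exists M => x Dx; rewrite ger0_norm// fM.
- have mEf : measurable_fun setT (fun x => (f x)%:E) by exact/measurable_EFinP.
  by rewrite -(integral_conull mD muD mEf)// -(integral_conull mD nuD mEf).
Qed.

Lemma laplace_transform_unique (R : realType) (mu nu : law R) :
  mu `]0, +oo[%classic = 1%E -> nu `]0, +oo[%classic = 1%E ->
  (forall l : R, (0 < l)%R -> \int[mu]_s (expR (- (l * s)))%:E =
                          \int[nu]_s (expR (- (l * s)))%:E)%E ->
  same_law mu nu.
Proof.
move=> mu1 nu1 munu; pose D : set (measurableTypeR R) := `]0, +oo[%classic.
have mD : measurable D by exact: measurable_itv.
have mexp (l : R) : measurable_fun [set: measurableTypeR R] (fun s => expR (- (l * s))).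
  by apply: measurableT_comp => //; apply: measurableT_comp.
have full (P : law R) (A : set R) : P D = 1%E -> measurable A -> D `<=` A -> P A = 1%E.
  move=> PD mA DA; apply/eqP; rewrite eq_le probability_le1//= -PD.
  by apply: le_measure; rewrite ?inE.
have moments k : same_int mu nu D (fun x : measurableTypeR R => 1 * expR (- x) ^+ k).
  apply: (@same_int_eq _ _ _ _ _ _ (fun x : measurableTypeR R => expR (- (k%:R * x)))).
    by move=> x _; rewrite mul1r -expRM_natl mulrN.
  apply: (same_int_conull mD mu1 nu1 (mexp _) (M := 1)).
  - by move=> x; exact: expR_ge0.
  - move=> x; rewrite /D /= in_itv/= andbT => x0.
    by rewrite -expR0 ler_expR oppr_le0 mulr_ge0// ltW.
  (* The k-th moment of exp (- x) is the Laplace transform at [k]; for k = 0, outside the range of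
     [munu], both integrals are 1. *)
  - have [->|k0] := posnP k; last by apply: munu; rewrite ltr0n.
    have e (P : law R) : (\int[P]_x (expR (- (0%:R * x)))%:E = 1)%E.
      rewrite (eq_integral (cst 1%E)); last by move=> x _; rewrite mul0r oppr0 expR0.
      by rewrite integral_cst// mul1e; exact: probability_setT.
    by rewrite !e.
apply: same_law_itvcy => t.
have [t0|t0] := leP t 0.
  have Dt : D `<=` `[t, +oo[%classic by apply: subset_itvr; rewrite bnd_simp.
  have mt : measurable (`[t, +oo[%classic : set (measurableTypeR R)) by exact: measurable_itv.
  exact: etrans (full mu _ mu1 mt Dt) (esym (full nu _ nu1 mt Dt)).
apply: (@same_int_measure _ _ _ mu nu D mD) => //.
  by move=> x; rewrite /D /= !in_itv/= !andbT; exact: lt_le_trans.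
have zb (x : measurableTypeR R) : D x -> 0 <= expR (- x) <= 1.
  rewrite /D/= in_itv/= andbT => x0.
  by rewrite expR_ge0 -expR0 ler_expR oppr_le0 ltW.
apply: same_int_eq (same_int_le mD (expR_gt0 (- t)) zb moments) => x _.
by rewrite mul1r ler_expR lerN2 indicE mem_setE in_itv/= andbT.
Qed.

Lemma pow1R (R : realType) (r : R) : 1 `^ r = 1.
Proof. by rewrite powR1. Qed.

Lemma powRN_addn (R : realType) (b t : R) (k : nat) : 0 < b ->
  b `^ (- (t + k%:R)) = b `^ (- t) * b^-1 ^+ k.
Proof.
move=> b0; rewrite opprD powRD; last by rewrite (gt_eqF b0) implybT.
by rewrite powR_invn ?exprVn// ltW.
Qed.

Lemma ge0_ler_powRN (R : realType) (a b s : R) : 0 <= s -> 0 < a -> a <= b ->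
  b `^ (- s) <= a `^ (- s).
Proof.
move=> s0 a0 ab; have b0 := lt_le_trans a0 ab.
rewrite !powRN lef_pV2 ?posrE ?powR_gt0//.
by rewrite ge0_ler_powR// nnegrE ltW.
Qed.

Lemma powR_continuous (R : realType) (r b : R) : 0 < b ->
  {for b, continuous (fun a : R => a `^ r)}.
Proof.
move=> b0; have := is_derive1_powR r b0.
by move=> [+ _] => /derivable1_diffP/differentiable_continuous.
Qed.

Section stieltjes.
Context (R : realType) (mu nu : law R) (tau : R).
Hypothesis tau_gt0 : 0 < tau.
Let D : set (measurableTypeR R) := `[0, +oo[%classic.
Let mD : measurable D. Proof. exact: measurable_itv. Qed.

Hypothesis mu1 : mu D = 1%E.
Hypothesis nu1 : nu D = 1%E.
Hypothesis munu : forall l : R, 0 < l ->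
  (\int[mu]_x ((1 + l * x) `^ (- tau))%:E = \int[nu]_x ((1 + l * x) `^ (- tau))%:E)%E.

Let base_gt0 (l x : R) : 0 <= l -> D x -> 0 < 1 + l * x.
Proof.
move=> l0; rewrite /D/= in_itv/= andbT => x0.
by rewrite ltr_pwDl// mulr_ge0.
Qed.

(** Up to a constant, the function is the k-th derivative of (1 + l x)^(- tau) in [l]. The induction
    differentiates under the integral: difference quotients in [l] inherit equal integrals and
    converge boundedly on [D]. *)
Lemma stieltjes_derivatives k (l : R) : 0 < l ->
  same_int mu nu D (fun x => x ^+ k * (1 + l * x) `^ (- (tau + k%:R))).
Proof.
elim: k l => [|k IH] l l0.
  have mf : measurable_fun [set: measurableTypeR R] (fun x => (1 + l * x) `^ (- tau)).
    apply: (measurableT_comp (measurable_powR _)).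
    by apply: measurable_funD => //; exact: measurable_funM.
  apply: (@same_int_eq _ _ _ _ _ _ (fun x : measurableTypeR R => (1 + l * x) `^ (- tau))).
    by move=> x _; rewrite expr0 mul1r addr0.
  apply: (same_int_conull mD mu1 nu1 mf (M := 1)).
  - by move=> x; exact: powR_ge0.
  - move=> x Dx; rewrite -[leRHS](pow1R (- tau)).
    rewrite ge0_ler_powRN ?(ltW tau_gt0)// lerDl; move: Dx; rewrite /D/= in_itv/= andbT => x0.
    by rewrite mulr_ge0// ltW.
  - exact: munu.
pose s := tau + k%:R.
have s_gt0 : 0 < s by rewrite ltr_pwDl.
have s0 : s != 0 by rewrite gt_eqF.
pose h n : R := n.+1%:R^-1.
have h0 n : 0 < h n by rewrite invr_gt0.
pose g (m x : R) := x ^+ k * (1 + m * x) `^ (- s).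
pose G (m x : R) := x ^+ k.+1 * (1 + m * x) `^ (- (tau + k.+1%:R)).
(* Difference quotient in the parameter with step 1/(n+1), normalized by the factor - s that
   differentiating the power - s produces; its limit is [G l x]. *)
pose f n x := (- s)^-1 * (h n)^-1 * (g (l + h n) x - g l x).
have fE n x : D x -> G (l + h n) x <= f n x <= G l x.
  move=> Dx; have x0 : 0 <= x by move: Dx; rewrite /D/= in_itv/= andbT.
  pose b := 1 + l * x; pose b' := 1 + (l + h n) * x.
  have b0 : 0 < b by apply: base_gt0 => //; exact: ltW.
  have bb : b <= b' by rewrite lerD2l ler_wpM2r// lerDl ltW.
  (* The mean value theorem in the base of the power turns the quotient into x^(k+1) c^(- (tau + k +
     1)) with c between [b] and [b']; monotonicity in c gives both the squeeze and the bound. *)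
  have [c /itvP cb fc] : exists2 c, c \in `[b, b'] &
      b' `^ (- s) - b `^ (- s) = - s * c `^ (- s - 1) * (b' - b).
    apply: (@MVT_segment _ (fun a => a `^ (- s)) (fun a => - s * a `^ (- s - 1))) => //.
      move=> y; rewrite in_itv/= => /andP[by_ _].
      by apply: is_derive1_powR; exact: lt_trans by_.
    apply: continuous_in_subspaceT => y; rewrite inE/= in_itv/= => /andP[by_ _].
    by apply: powR_continuous; exact: lt_le_trans by_.
  have -> : f n x = x ^+ k.+1 * c `^ (- (tau + k.+1%:R)).
    rewrite /f /g -mulrBr -/b -/b' fc.
    have -> : - s - 1 = - (tau + k.+1%:R) by rewrite /s -natr1; ring.
    have -> : b' - b = h n * x by rewrite /b /b'; ring.
    have := h0 n; rewrite exprS => /gt_eqF/negbT hn0; field.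
    by rewrite ?oppr_eq0 ?s0 ?hn0.
  have t0 : 0 <= tau + k.+1%:R by rewrite addr_ge0// ltW.
  have c0 : 0 < c by apply: lt_le_trans b0 _; rewrite cb.
  by rewrite /G !ler_wpM2l ?exprn_ge0//= ge0_ler_powRN// ?cb.
have G0 m x : D x -> 0 <= G m x.
  rewrite /D/= in_itv/= andbT => x0.
  by rewrite /G mulr_ge0 ?exprn_ge0 ?powR_ge0.
(* The growing factor is absorbed: x / (1 + l x) <= 1 / l, while (1 + l x)^(- tau) <= 1. *)
have GM x : D x -> G l x <= l^-1 ^+ k.+1.
  move=> Dx; have x0 : 0 <= x by move: Dx; rewrite /D/= in_itv/= andbT.
  have b0 : 0 < 1 + l * x by apply: base_gt0 => //; exact: ltW.
  rewrite /G powRN_addn// mulrCA -exprMn -[leRHS]mul1r ler_pM//.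
  - exact: powR_ge0.
  - by rewrite exprn_ge0// mulr_ge0// invr_ge0 ltW.
  - rewrite -[leRHS](pow1R (- tau)) ge0_ler_powRN ?(ltW tau_gt0)// lerDl mulr_ge0// ltW//.
  - rewrite lerXn2r ?nnegrE ?mulr_ge0 ?invr_ge0 ?(ltW l0) ?(ltW b0)//.
    by rewrite ler_pdivrMr// ler_pdivlMl//; lra.
apply: (@same_int_lim _ _ _ mu nu D mD f _ (l^-1 ^+ k.+1)).
- move=> n; apply: same_intZ => //.
  have ln0 : 0 < l + h n by rewrite addr_gt0.
  have := same_intD mD (IH _ ln0) (same_intZ mD (-1) (IH _ l0)).
  by apply: same_int_eq => x _; rewrite mulN1r.
- move=> n x Dx; have /andP[fG fG'] := fE n x Dx.
  by rewrite ger0_norm ?(le_trans fG')// ?GM// (le_trans _ fG)// G0.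
- move=> x Dx.
  apply: (@squeeze_cvgr _ _ _ _ (fun n => G (l + h n) x) (fun=> G l x)).
  + by apply: nearW => n; exact: fE.
  + apply: cvgMr.
    have b0 : 0 < 1 + l * x by apply: base_gt0 => //; exact: ltW.
    apply: (cvg_comp (fun n => 1 + (l + h n) * x) (fun a => a `^ _) _ (powR_continuous b0)).
    apply: cvgD; first exact: cvg_cst.
    apply: cvgMl; rewrite -[X in _ --> X]addr0.
    by apply: cvgD; [exact: cvg_cst|exact: cvg_harmonic].
  + exact: cvg_cst.
Qed.


(** With z = l x / (1 + l x), the weighted moments are l^k times the functions of
    [stieltjes_derivatives]. As z increases with x, the threshold l s / (1 + l s) for z is the
    threshold s for x. *)
Lemma stieltjes_truncated (l s : R) : 0 < l -> 0 < s ->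
  same_int mu nu D (fun x => (1 + l * x) `^ (- tau) * (x <= s)%R%:R).
Proof.
move=> l0 s0; pose z (x : measurableTypeR R) := l * x / (1 + l * x).
have ls0 : 0 < 1 + l * s by rewrite ltr_pwDl// mulr_ge0// ltW.
have a0 : 0 < l * s / (1 + l * s) by rewrite divr_gt0// mulr_gt0.
have zb x : D x -> 0 <= z x <= 1.
  move=> Dx; have x0 : 0 <= x by move: Dx; rewrite /D/= in_itv/= andbT.
  have b0 : 0 < 1 + l * x by apply: base_gt0 => //; exact: ltW.
  have lx0 : 0 <= l * x by rewrite mulr_ge0// ltW.
  by rewrite divr_ge0 ?(ltW b0)//= ler_pdivrMr// mul1r lerDr.
have moments k : same_int mu nu D (fun x => (1 + l * x) `^ (- tau) * z x ^+ k).
  have := same_intZ mD (l ^+ k) (stieltjes_derivatives k l0).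
  apply: same_int_eq => x Dx.
  have b0 : 0 < 1 + l * x by apply: base_gt0 => //; exact: ltW.
  by rewrite powRN_addn// /z !exprMn; ring.
apply: same_int_eq (same_int_le mD a0 zb moments) => x Dx.
have b0 : 0 < 1 + l * x by apply: base_gt0 => //; exact: ltW.
congr (_ * _%:R); rewrite /z ler_pdivrMr// mulrAC ler_pdivlMr//.
have -> : l * x * (1 + l * s) = l * x + l * l * x * s by ring.
have -> : l * s * (1 + l * x) = l * s + l * l * x * s by ring.
by rewrite lerD2r ler_pM2l.
Qed.

Lemma stieltjes_transform_unique : same_law mu nu.
Proof.
have mI (t : R) : same_int mu nu D (fun x => (x <= t)%R%:R).
  have [t0|t0] := ltP t 0.
    (* The indicator vanishes on [D], hence agrees there with 0 times any function already
       treated. *)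
    have H := stieltjes_truncated ltr01 ltr01.
    apply: same_int_eq (same_intZ mD 0 H) => x.
    rewrite /D/= in_itv/= andbT mul0r => x0.
    by rewrite leNgt (lt_le_trans t0 x0).
  pose h n : R := n.+1%:R^-1.
  have h0 n : 0 < h n by rewrite invr_gt0.
  have ht n : 0 < t + h n by rewrite ltr_wpDl.
  (* Letting l = h n tend to 0 removes the weight. The cut is at [t + h n] because truncation needs
     a positive level and t may be 0; for fixed x the shifted indicator is eventually that of x <=
     t. *)
  apply: (@same_int_lim _ _ _ mu nu D mD
    (fun n x => (1 + h n * x) `^ (- tau) * (x <= t + h n)%R%:R) _ 1).
  - by move=> n; exact: stieltjes_truncated.
  - move=> n x Dx; have x0 : 0 <= x by move: Dx; rewrite /D/= in_itv/= andbT.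
    rewrite ger0_norm ?mulr_ge0 ?powR_ge0// -[leRHS]mulr1 ler_pM ?powR_ge0//.
      rewrite -[leRHS](pow1R (- tau)) ge0_ler_powRN ?(ltW tau_gt0)//.
      by rewrite lerDl mulr_ge0// ltW.
    by case: (x <= t + h n).
  - move=> x Dx; have x0 : 0 <= x by move: Dx; rewrite /D/= in_itv/= andbT.
    rewrite -[X in _ --> X]mul1r; apply: cvgM.
      rewrite -[X in _ --> X](pow1R (- tau)).
      have h1 : 1 + h n * x @[n --> \oo] --> (1 : R).
        rewrite -[X in _ --> X]addr0; apply: cvgD; first exact: cvg_cst.
        by rewrite -[X in _ --> X](mul0r x); apply: cvgMl; exact: cvg_harmonic.
      exact: cvg_comp h1 (powR_continuous (@ltr01 R)).
    have [xt|tx] := leP x t.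
      apply: cvg_near_cst; apply: nearW => n.
      by rewrite (le_trans xt)// lerDl ltW.
    apply: cvg_near_cst.
    have hx : h n @[n --> \oo] --> (0 : R) by exact: cvg_harmonic.
    have xt0 : 0 < x - t by rewrite subr_gt0.
    near=> n; suff : h n < x - t by rewrite ltrBrDl leNgt => ->.
    by near: n; exact: cvgr_lt hx _ xt0.
apply: same_law_itvoy => t.
have [t0|t0] := ltP t 0.
  have full (P : law R) : P D = 1%E -> P `]t, +oo[%classic = 1%E.
    move=> PD; apply/eqP; rewrite eq_le probability_le1//= -PD.
    by apply: le_measure; rewrite ?inE//; apply: subset_itvr; rewrite bnd_simp.
  exact: etrans (full mu mu1) (esym (full nu nu1)).
apply: (@same_int_measure _ _ _ mu nu D mD) => //.
  by move=> x; rewrite /D /= !in_itv/= !andbT => /ltW; exact: le_trans.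
have all1 : same_int mu nu D (fun=> 1).
  have mc : measurable_fun [set: measurableTypeR R] (fun=> 1 : R) by exact: measurable_cst.
  apply: (same_int_conull mD mu1 nu1 mc (M := 1)) => //.
  have e (P : law R) : (\int[P]_x (1 : R)%:E = 1)%E.
    by rewrite integral_cst// mul1e; exact: probability_setT.
  exact: etrans (e mu) (esym (e nu)).
apply: same_int_eq (same_intD mD all1 (same_intZ mD (-1) (mI t))) => y Dy.
rewrite indicE mem_setE in_itv/= andbT ltNge.
by case: (y <= t); rewrite mulN1r ?subrr ?subr0.
Unshelve. all: by end_near. Qed.

End stieltjes.

(** * Stable laws *)

Lemma image_law_exists (R : realType) d (T : measurableType d)
    (P : probability T R) (f : T -> measurableTypeR R) :
  measurable_fun setT f -> exists mu : law R, image_law P f mu.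
Proof.
move=> mf; pose F : {mfun T >-> measurableTypeR R} :=
  HB.pack f (isMeasurableFun.Build _ _ _ _ f mf).
by exists (distribution P F); split.
Qed.

Lemma ge0_integral_image_law (R : realType) d (T : measurableType d)
    (P : {measure set T -> \bar R}) (f : T -> measurableTypeR R) (mu : law R)
    (g : measurableTypeR R -> \bar R) :
  image_law P f mu -> measurable_fun setT g -> (forall x, 0 <= g x)%E ->
  (\int[mu]_x g x = \int[P]_x g (f x))%E.
Proof.
move=> [mf muE] mg g0.
pose F : {mfun T >-> measurableTypeR R} :=
  HB.pack f (isMeasurableFun.Build _ _ _ _ f mf).
rewrite (@eq_measure_integral _ _ _ _ (pushforward P F)); last by move=> A mA _; exact: muE.
by rewrite (ge0_integral_pushforward mf).
Qed.

Lemma image_law_conull (R : realType) d (T : measurableType d)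
    (P : {measure set T -> \bar R}) (f : T -> measurableTypeR R) (mu : law R)
    (A : set (measurableTypeR R)) : measurable A ->
  image_law P f mu -> P (f @^-1` A) = 1%E -> mu A = 1%E.
Proof. by move=> mA [_ ->]. Qed.


Lemma probability1_sub d (T : measurableType d) (R : realType)
    (P : probability T R) (A B : set T) :
  measurable A -> measurable B -> A `<=` B -> P A = 1%E -> P B = 1%E.
Proof.
move=> mA mB AB PA; apply/eqP; rewrite eq_le probability_le1//= -PA.
by apply: le_measure; rewrite ?inE.
Qed.

Lemma eq_integral_conull d (T : measurableType d) (R : realType)
    (P : probability T R) (D : set T) (f g : T -> \bar R) :
  measurable D -> P D = 1%E -> measurable_fun setT f -> measurable_fun setT g ->
  (forall x, D x -> f x = g x) -> (\int[P]_x f x = \int[P]_x g x)%E.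
Proof.
move=> mD PD mf mg fg; apply: ae_eq_integral => //.
exists (~` D); split; first exact: measurableC.
  by have := probability_setC P mD; rewrite PD subee.
by move=> x /= H Dx; apply: H => _; exact: fg.
Qed.

Lemma product_probability1 d d' (T : measurableType d) (T' : measurableType d')
    (R : realType) (P : probability T R) (Q : probability T' R)
    (A : set T) (B : set T') : measurable A -> measurable B ->
  P A = 1%E -> Q B = 1%E -> (P \x Q)%E (A `*` B) = 1%E.
Proof.
move=> mA mB PA QB.
exact: etrans (product_measure1E P Q mA mB) (etrans (congr2 mule PA QB) (mule1 _)).
Qed.

Section stable.
Context (R : realType) (gamma : R) (sigma : law R).
Hypothesis gamma_gt0 : 0 < gamma.
Hypothesis stable_sigma : stable_law gamma sigma.
Let pos : set (measurableTypeR R) := `]0, +oo[%classic.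
Let mpos : measurable pos. Proof. exact: measurable_itv. Qed.
Let sigma1 : sigma pos = 1%E. Proof. by case: stable_sigma. Qed.
Let posE x : pos x = (0 < x) :> Prop.
Proof. by rewrite /pos/= in_itv/= andbT. Qed.

Let sigma_laplace (l : R) : 0 < l ->
  (\int[sigma]_x (expR (- (l * x)))%:E = (expR (- (l `^ gamma)))%:E)%E.
Proof. by case: stable_sigma => _; apply. Qed.

Let mexp (l : R) : measurable_fun [set: measurableTypeR R]
  (fun x => (expR (- (l * x)))%:E).
Proof.
apply/measurable_EFinP; apply: measurableT_comp => //.
by apply: measurableT_comp.
Qed.

Let msum (s : R) : measurable_fun setT
  (fun z : measurableTypeR R * measurableTypeR R => z.2 + s * z.1).
Proof.
by apply: measurable_funD => //; apply: measurable_funM.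
Qed.

(** By independence and by scaling respectively, both laws have Laplace transform exp (- (1 +
    s^gamma) l^gamma). *)
Lemma stable_convolution (s : R) (g : measurableTypeR R -> \bar R) : 0 < s ->
  measurable_fun setT g -> (forall x, 0 <= g x)%E ->
  (\int[sigma \x sigma]_z g (z.2 + s * z.1)%R =
   \int[sigma]_x g ((1 + s `^ gamma) `^ gamma^-1 * x)%R)%E.
Proof.
move=> s0 mg g0; pose k : R := (1 + s `^ gamma) `^ gamma^-1.
have k0 : 0 < k by rewrite powR_gt0// ltr_pwDl// powR_ge0.
have [mu1 mu1E] := @image_law_exists _ _ _ (sigma \x sigma)%E _ (msum s).
have mk : measurable_fun setT
    (fun x : measurableTypeR R => k * x : measurableTypeR R).
  exact: measurable_funM.
have [mu2 mu2E] := @image_law_exists _ _ _ sigma _ mk.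
rewrite -(ge0_integral_image_law mu1E mg g0).
rewrite -(ge0_integral_image_law mu2E mg g0).
apply: eq_measure_integral => A mA _; move: A mA.
apply: laplace_transform_unique.
- apply: (image_law_conull mpos mu1E).
  apply: (probability1_sub _ _ _ (product_probability1 mpos mpos sigma1 sigma1)).
  + exact: measurableX.
  + by rewrite -[X in measurable X]setTI; exact: msum.
  + move=> [x y] /=; rewrite !posE /= => -[x0 y0].
    by rewrite addr_gt0// mulr_gt0.
- apply: (image_law_conull mpos mu2E).
  apply: (probability1_sub mpos _ _ sigma1).
  + by rewrite -[X in measurable X]setTI; exact: mk.
  + by move=> x /=; rewrite !posE => x0; rewrite mulr_gt0.
- move=> l l0; have e0 (m x : R) : (0 <= (expR (- (m * x)))%:E)%E.
    by rewrite lee_fin expR_ge0.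
  rewrite (ge0_integral_image_law mu1E (mexp l))//.
  rewrite (ge0_integral_image_law mu2E (mexp l))//=.
  rewrite fubini_tonelli1//; last first.
    exact: (measurableT_comp (mexp l) (msum s)).
  have inner x : (\int[sigma]_y (expR (- (l * (y + s * x))))%:E =
      (expR (- (l `^ gamma)))%:E * (expR (- (l * s * x)))%:E)%E.
    rewrite (eq_integral (fun y : measurableTypeR R =>
      (expR (- (l * s * x)))%:E * (expR (- (l * y)))%:E)%E).
      by rewrite ge0_integralZl// sigma_laplace// muleC.
    by move=> y _; rewrite -EFinM -expRD; congr (expR _)%:E; ring.
  transitivity (\int[sigma]_x
      ((expR (- (l `^ gamma)))%:E * (expR (- (l * s * x)))%:E))%E.
    by apply: eq_integral => x _; exact: inner.
  rewrite ge0_integralZl//.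
  rewrite sigma_laplace ?mulr_gt0//.
  rewrite (eq_integral (fun x : measurableTypeR R => (expR (- (l * k * x)))%:E)); last first.
    by move=> x _; rewrite mulrA.
  rewrite sigma_laplace ?mulr_gt0// -EFinM -expRD -opprD; congr (expR (- _))%:E.
  rewrite !powRM ?ltW//.
  rewrite /k -powRrM mulVf ?gt_eqF// powRr1 ?addr_ge0 ?powR_ge0//.
  by rewrite mulrDr mulr1 addrC.
Qed.

End stable.

(** * Truncation to a symmetric interval *)

Section clamp.
Context (R : realType).
Implicit Types n m t u : R.

Definition clamp n t : R := Num.max (- n) (Num.min t n).

Variant clamp_spec n t : R -> Prop :=
| ClampLow of t < - n : clamp_spec n t (- n)
| ClampMid of - n <= t & t <= n : clamp_spec n t t
| ClampHigh of n < t : clamp_spec n t n.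

Lemma clampP n t : 0 <= n -> clamp_spec n t (clamp n t).
Proof.
move=> n0; rewrite /clamp; case: (leP t n) => tn.
  by case: (leP (- n) t) => nt; constructor.
by rewrite max_r; [constructor|lra].
Qed.

Lemma clamp_id n t : `|t| <= n -> clamp n t = t.
Proof.
move=> tn; have n0 : 0 <= n by rewrite (le_trans _ tn).
by move: tn; rewrite ler_norml; case: clampP => //; lra.
Qed.

Lemma clamp_bound n t : 0 <= n -> - n <= clamp n t <= n.
Proof. by move=> n0; case: clampP => //; lra. Qed.

(** The upper bound does not depend on the level [n], so it dominates all truncated increments at
    once. *)
Lemma clamp_increment n t u : 0 <= n -> t <= u ->
  0 <= clamp n u - clamp n t <= u - t.
Proof. by move=> n0; case: clampP => //; case: clampP => //; lra. Qed.

(** A higher level cuts off less of the segment from [t] to [u]; this provides the monotonicity for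
    monotone convergence. *)
Lemma clamp_increment_nondecreasing n m t u : 0 <= n -> n <= m -> t <= u ->
  clamp n u - clamp n t <= clamp m u - clamp m t.
Proof.
move=> n0 nm; have m0 := le_trans n0 nm.
by case: (clampP t n0); case: (clampP u n0); case: (clampP t m0);
  case: (clampP u m0); lra.
Qed.

Lemma clamp_cvg t : clamp n%:R t @[n --> \oo] --> t.
Proof.
apply: cvg_near_cst; near=> n; apply: clamp_id.
by near: n; exact: nbhs_infty_ger.
Unshelve. all: by end_near. Qed.

Lemma measurable_clamp n : measurable_fun [set: R] (clamp n).
Proof. by apply: measurable_maxr => //; exact: measurable_minr. Qed.

End clamp.

(** * Logarithmic moment of a ratio of stable variables *)

Section log_moment.
Context (R : realType) (gamma : R) (sigma : law R).
Hypothesis gamma_gt0 : 0 < gamma.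
Hypothesis stable_sigma : stable_law gamma sigma.
Let pos : set (measurableTypeR R) := `]0, +oo[%classic.
Let mpos : measurable pos. Proof. exact: measurable_itv. Qed.
Let sigma1 : sigma pos = 1%E. Proof. by case: stable_sigma. Qed.
Let posE x : pos x = (0 < x) :> Prop.
Proof. by rewrite /pos/= in_itv/= andbT. Qed.

(* The shift by n makes it nonnegative, so that integrals need no integrability
   condition. *)
Let U (n : nat) (x : measurableTypeR R) : R := clamp n%:R (ln x) + n%:R.

Let U_ge0 n x : (0 <= (U n x)%:E)%E.
Proof.
by rewrite lee_fin /U; have /andP[] := clamp_bound (ln x) (ler0n R n); lra.
Qed.

Let mU n : measurable_fun setT (fun x => (U n x)%:E).
Proof.
apply/measurable_EFinP; apply: measurable_funD => //.
by apply: measurableT_comp; [exact: measurable_clamp|exact: measurable_ln].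
Qed.

Let int_U_fin n : (\int[sigma]_x (U n x)%:E)%E \is a fin_num.
Proof.
apply: integrable_fin_num => //.
apply: (@bounded_integrable _ _ _ _ measurableT _ (U n) (n%:R + n%:R)).
  exact: (measurable_EFinP _ _).1 (mU n).
move=> x _; have /andP[] := clamp_bound (ln x) (ler0n R n).
by move=> c0 c1; rewrite /U ger0_norm ?lerD2r// -lerBlDr sub0r.
Qed.

(** Since ln (k x) = ln k + ln x, the truncated increment tends to ln k and stays between 0 and ln
    k. *)
Let scaled_increment (k : R) : 1 <= k ->
  (\int[sigma]_(x in pos) (U n (k * x) - U n x)%:E)%E @[n --> \oo]
    --> ((ln k)%:E : \bar R).
Proof.
move=> k1; have k0 : 0 < k by lra.
have lnk0 : 0 <= ln k by rewrite ln_ge0.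
have mkU n : measurable_fun setT (fun x : measurableTypeR R => U n (k * x) - U n x).
  apply: measurable_funB; last exact: (measurable_EFinP _ _).1 (mU n).
  apply: (measurableT_comp ((measurable_EFinP _ _).1 (mU n))).
  exact: measurable_funM.
have [] := @dominated_convergence _ _ R sigma pos mpos
  (fun n x => (U n (k * x) - U n x)%:E) (cst (ln k)%:E) (cst (ln k)%:E).
- by move=> n; apply: measurable_funTS; exact/measurable_EFinP.
- exact: measurable_cst.
- apply: aeW => x; rewrite posE => x0; apply: cvg_EFin; first exact: nearW.
  have c : clamp n%:R (ln k + ln x) - clamp n%:R (ln x) @[n --> \oo] --> ln k.
    rewrite -[X in _ --> X](addrK (ln x) (ln k)).
    by apply: cvgB; exact: clamp_cvg.
  apply: cvg_trans c; apply: near_eq_cvg; apply: nearW => n /=.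
  by rewrite /U lnM ?posrE//; ring.
- exact: finite_measure_integrable_cst.
- apply: aeW => x n; rewrite posE => x0; rewrite lee_fin /U lnM ?posrE//.
  have : ln x <= ln k + ln x by rewrite lerDr.
  move=> /(clamp_increment (ler0n R n))/andP[c0 c1].
  by rewrite ler_norml; apply/andP; split; lra.
move=> _ _; rewrite integral_cst//.
by rewrite [X in (_ * X)%E](_ : _ = 1%E) ?mule1//; exact: sigma1.
Qed.

Let D := pos `*` pos.
Let mD : measurable D. Proof. exact: measurableX. Qed.
Let sigma2 : (sigma \x sigma)%E D = 1%E.
Proof. exact: product_probability1. Qed.

Let msum (s : R) : measurable_fun setT
  (fun z : measurableTypeR R * measurableTypeR R => z.2 + s * z.1).
Proof.
by apply: measurable_funD => //; apply: measurable_funM.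
Qed.

(** The difference of logarithms cannot be split under the integral directly, as ln S may fail to be
    integrable a priori. At each truncation level it can be split, and [stable_convolution] replaces
    S' + s S by k S. Then the level tends to infinity, by monotone convergence on the product and by
    [scaled_increment] on the line. *)
Lemma stable_ratio_log (s : R) : 0 < s ->
  (\int[sigma \x sigma]_(z in D) (ln (z.2 + s * z.1) - ln z.2)%:E =
   (gamma^-1 * ln (1 + s `^ gamma))%:E)%E.
Proof.
move=> s0; pose k : R := (1 + s `^ gamma) `^ gamma^-1.
have k1 : 1 <= k.
  rewrite -[leLHS](pow1R gamma^-1) ge0_ler_powR ?nnegrE ?invr_ge0 ?ltW//.
    by rewrite ltr_pwDl// powR_ge0.
  by rewrite ltrDl powR_gt0.
have -> : gamma^-1 * ln (1 + s `^ gamma) = ln k.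
  by rewrite /k ln_powR.
pose d n (z : measurableTypeR R * measurableTypeR R) :=
  (U n (z.2 + s * z.1) - U n z.2)%:E.
have mUs n : measurable_fun setT (fun z : measurableTypeR R * measurableTypeR R =>
    (U n (z.2 + s * z.1))%:E).
  exact: (measurableT_comp (mU n) (msum s)).
have mU2 n : measurable_fun setT (fun z : measurableTypeR R * measurableTypeR R =>
    (U n z.2)%:E).
  exact: (measurableT_comp (mU n)).
have md n : measurable_fun setT (d n).
  apply/measurable_EFinP; apply: measurable_funB.
    exact: (measurable_EFinP _ _).1 (mUs n).
  exact: (measurable_EFinP _ _).1 (mU2 n).
have Dln z : D z -> ln z.2 <= ln (z.2 + s * z.1).
  case: z => x y [] /=; rewrite !posE => x0 y0.
  by rewrite ler_ln ?posrE ?addr_gt0 ?mulr_gt0// lerDl mulr_ge0// ltW.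
have dE n z : d n z = (clamp n%:R (ln (z.2 + s * z.1)) - clamp n%:R (ln z.2))%:E.
  by rewrite /d /U; congr EFin; ring.
have d0 n z : D z -> (0 <= d n z)%E.
  move=> /Dln /(clamp_increment (ler0n R n))/andP[+ _].
  by rewrite dE lee_fin.
have cvg1 : (\int[sigma \x sigma]_(z in D) d n z)%E @[n --> \oo] -->
    (\int[sigma \x sigma]_(z in D) (ln (z.2 + s * z.1) - ln z.2)%:E)%E.
  have := @cvg_monotone_convergence _ _ R (sigma \x sigma)%E D mD d.
  rewrite (@eq_integral _ _ _ _ D (fun z => (ln (z.2 + s * z.1) - ln z.2)%:E)
    (fun z => limn (d ^~ z))).
    apply => //; first by move=> n; exact: measurable_funTS.
    move=> z Dz n m nm; rewrite !dE lee_fin.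
    by apply: clamp_increment_nondecreasing; rewrite ?ler_nat//; exact: Dln.
  move=> z /[!inE] Dz; apply/cvg_lim => //.
  under eq_fun do rewrite dE.
  apply: cvg_EFin; first exact: nearW.
  by apply: cvgB; exact: clamp_cvg.
have dint n : (\int[sigma \x sigma]_(z in D) d n z)%E =
    (\int[sigma]_(x in pos) (U n (k * x) - U n x)%:E)%E.
  have mkU : measurable_fun setT (fun x : measurableTypeR R => (U n (k * x))%:E).
    by apply: (measurableT_comp (mU n)); exact: measurable_funM.
  have fin2 : (\int[sigma \x sigma]_z (U n z.2)%:E = \int[sigma]_x (U n x)%:E)%E.
    rewrite fubini_tonelli1// /fubini_F/=.
    rewrite integral_cst//.
    by rewrite [X in (_ * X)%E](_ : _ = 1%E) ?mule1//; exact: probability_setT.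
  (* Both integrals become equal once the integral of [U n] is added to them; that integral is
     finite, so it can be cancelled in the extended reals. *)
  have e1 : (\int[sigma \x sigma]_(z in D) d n z + \int[sigma]_x (U n x)%:E =
      \int[sigma]_x (U n (k * x))%:E)%E.
    rewrite -fin2 (integral_conull mD sigma2 (mU2 n))// -ge0_integralD//; last 3 first.
      exact: d0.
      exact: measurable_funTS.
      exact: measurable_funTS.
    rewrite -(stable_convolution gamma_gt0 stable_sigma s0 (mU n))//.
    rewrite (integral_conull mD sigma2 (mUs n))//.
    by apply: eq_integral => z _; rewrite /d -EFinD subrK.
  have e2 : (\int[sigma]_(x in pos) (U n (k * x) - U n x)%:E + \int[sigma]_x (U n x)%:E =
      \int[sigma]_x (U n (k * x))%:E)%E.
    rewrite (integral_conull mpos sigma1 (mU n))// -ge0_integralD//.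
    - rewrite (integral_conull mpos sigma1 mkU)//.
      by apply: eq_integral => z _; rewrite -EFinD subrK.
    - move=> x; rewrite posE => x0; rewrite lee_fin /U.
      have k0 : 0 < k by lra.
      have : ln x <= ln (k * x) by rewrite ler_ln ?posrE ?mulr_gt0// ler_peMl// ltW.
      by move=> /(clamp_increment (ler0n R n))/andP[]; lra.
    - apply: measurable_funTS; apply/measurable_EFinP.
      apply: measurable_funB; first exact: (measurable_EFinP _ _).1 mkU.
      exact: (measurable_EFinP _ _).1 (mU n).
    - exact: measurable_funTS.
  move: e1; rewrite -e2 => /(congr1 (fun t => t - \int[sigma]_x (U n x)%:E)%E).
  by rewrite !addeK.
rewrite -(cvg_lim _ cvg1)//; apply/cvg_lim => //.
under eq_fun do rewrite dint.
exact: scaled_increment.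
Qed.

End log_moment.

(** * Transforms of Lambda and of Dirichlet means *)

Lemma X_law_pos (R : realType) (gamma : R) (X : law R) : X_law gamma X ->
  X `]0, +oo[%classic = 1%E.
Proof.
move=> [sigma [sigma1 _] XE].
pose pos : set (measurableTypeR R) := `]0, +oo[%classic.
have mpos : measurable pos by exact: measurable_itv.
apply: (image_law_conull mpos XE).
apply: (probability1_sub _ _ _ (product_probability1 mpos mpos sigma1 sigma1)).
- exact: measurableX.
- by rewrite -[X in measurable X]setTI; exact: XE.1.
- move=> [x y] /=; rewrite /pos/= !in_itv/= !andbT => -[x0 y0].
  exact: divr_gt0.
Qed.

(** The absolute value keeps the integrand nonnegative on the whole line, as the change of variables
    for nonnegative functions demands; it is invisible to laws carried by the positive half-line. *)
Lemma measurable_ln1D (R : realType) (s : R) :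
  measurable_fun [set: measurableTypeR R] (fun x => (ln (1 + s * `|x|))%:E).
Proof.
apply/measurable_EFinP; apply: (measurableT_comp (@measurable_ln R)).
apply: measurable_funD => //; apply: measurable_funM => //.
Qed.

Lemma ln1D_ge0 (R : realType) (s x : R) : 0 <= s -> (0 <= (ln (1 + s * `|x|))%:E)%E.
Proof. by move=> s0; rewrite lee_fin ln_ge0// lerDl mulr_ge0. Qed.

(** For positive S and S', ln (1 + s S/S') = ln (S' + s S) - ln S'. *)
Lemma X_law_log (R : realType) (gamma s : R) (X : law R) : 0 < gamma ->
  X_law gamma X -> 0 < s ->
  (\int[X]_x (ln (1 + s * `|x|))%:E = (gamma^-1 * ln (1 + s `^ gamma))%:E)%E.
Proof.
move=> gamma0 [sigma st XE] s0.
pose pos : set (measurableTypeR R) := `]0, +oo[%classic.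
have mpos : measurable pos by exact: measurable_itv.
have f0 x := ln1D_ge0 x (ltW s0).
rewrite (ge0_integral_image_law XE (measurable_ln1D s))//.
have s2 := product_probability1 mpos mpos st.1 st.1.
have mD : measurable (pos `*` pos) by exact: measurableX.
rewrite (integral_conull mD s2)//; last first.
  exact: (measurableT_comp (measurable_ln1D s) XE.1).
rewrite -(stable_ratio_log gamma0 st s0).
apply: eq_integral => -[x y] /[!inE] -[] /=; rewrite /pos/= !in_itv/= !andbT => x0 y0.
have sx : 0 < y + s * x by rewrite addr_gt0// mulr_gt0.
rewrite gtr0_norm ?divr_gt0// -ln_div ?posrE//; congr (ln _)%:E.
by rewrite mulrDl divff ?gt_eqF// mulrA.
Qed.

(** Since 1 + l a X / (1 + a X) = (1 + (1 + l) a X) / (1 + a X), the integral is a difference of two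
    values of [X_law_log], at (1 + l) a and at a, with a^gamma = p / (1 - p). *)
Lemma Lambda_law_log (R : realType) (gamma p l : R) (L : law R) : 0 < gamma ->
  0 < p < 1 -> Lambda_law gamma p L -> 0 < l ->
  (\int[L]_x (ln (1 + l * x))%:E =
   (gamma^-1 * ln (1 - p + p * (1 + l) `^ gamma))%:E)%E.
Proof.
move=> gamma0 /andP[p0 p1] [X HX]; set a : R := _ `^ _; move=> /= LE l0.
have q0 : 0 < 1 - p by rewrite subr_gt0.
have a0 : 0 < a by rewrite powR_gt0// divr_gt0.
pose pos : set (measurableTypeR R) := `]0, +oo[%classic.
have mpos : measurable pos by exact: measurable_itv.
have Xpos : X pos = 1%E := X_law_pos HX.
have posE x : pos x = (0 < x) :> Prop by rewrite /pos/= in_itv/= andbT.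
have Lpos : L pos = 1%E.
  apply: (image_law_conull mpos LE); apply: (probability1_sub mpos _ _ Xpos).
    by rewrite -[X in measurable X]setTI; exact: LE.1.
  move=> x /=; rewrite !posE => x0.
  by rewrite divr_gt0// ?addr_gt0 ?mulr_gt0.
pose m := (1 + l) * a.
have m0 : 0 < m by rewrite mulr_gt0// addr_gt0.
transitivity (\int[L]_x (ln (1 + l * `|x|))%:E)%E.
  apply: (eq_integral_conull mpos Lpos).
  - apply/measurable_EFinP; apply: (measurableT_comp (@measurable_ln R)).
    by apply: measurable_funD => //; exact: measurable_funM.
  - exact: measurable_ln1D.
  - by move=> x; rewrite posE => x0; rewrite gtr0_norm.
rewrite (ge0_integral_image_law LE (measurable_ln1D l)); last first.
  by move=> x; apply: ln1D_ge0; exact: ltW.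
have mI := measurableT_comp (measurable_ln1D l) LE.1.
set I := (\int[X]_x _)%E.
(* Stated as a sum, so that only nonnegative functions are integrated; the finite second term is
   subtracted afterwards. *)
have e : (I + \int[X]_x (ln (1 + a * `|x|))%:E = \int[X]_x (ln (1 + m * `|x|))%:E)%E.
  rewrite -ge0_integralD//.
  - apply: (eq_integral_conull mpos Xpos).
    + by apply: emeasurable_funD => //; exact: measurable_ln1D.
    + exact: measurable_ln1D.
    + move=> x; rewrite posE => x0.
      have ax : 0 < a * x by rewrite mulr_gt0.
      have ax1 : 0 < 1 + a * x by rewrite addr_gt0.
      have r0 : 0 < a * x / (1 + a * x) by rewrite divr_gt0.
      have lr : 0 < 1 + l * (a * x / (1 + a * x)) by rewrite ltr_pwDl// mulr_ge0// ltW.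
      rewrite !gtr0_norm// -EFinD -lnM ?posrE//.
      by congr (ln _)%:E; rewrite /m; field; rewrite gt_eqF.
  - by move=> x _; apply: ln1D_ge0; exact: ltW.
  - by move=> x _; apply: ln1D_ge0; exact: ltW.
  - exact: measurable_ln1D.
move: e; rewrite !(X_law_log gamma0 HX)//.
move=> /(congr1 (fun t => t - (gamma^-1 * ln (1 + a `^ gamma))%:E)%E).
rewrite addeK// => ->; rewrite -EFinB -mulrBr.
have aE : a `^ gamma = p / (1 - p).
  by rewrite /a -powRrM mulVf ?gt_eqF// powRr1// divr_ge0 ?ltW.
have l10 : 0 < (1 + l) `^ gamma by rewrite powR_gt0// addr_gt0.
rewrite /m powRM ?ltW ?addr_gt0// aE.
have pq : 0 < p / (1 - p) by rewrite divr_gt0.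
have A0 : 0 < 1 + (1 + l) `^ gamma * (p / (1 - p)) by rewrite addr_gt0// mulr_gt0.
have B0 : 0 < 1 + p / (1 - p) by rewrite addr_gt0.
rewrite -ln_div ?posrE//.
suff -> : (1 + (1 + l) `^ gamma * (p / (1 - p))) / (1 + p / (1 - p)) =
  1 - p + p * (1 + l) `^ gamma by [].
by field; rewrite gt_eqF//=; lra.
Qed.

Lemma PD_base_gt0 (R : realType) (gamma p l : R) : 0 < p < 1 -> 0 < l ->
  0 < 1 - p + p * (1 + l) `^ gamma.
Proof.
move=> /andP[p0 p1] l0.
by rewrite addr_gt0 ?subr_gt0// mulr_gt0// powR_gt0// addr_gt0.
Qed.

(** With B = 1 - p + p (1 + l)^gamma, the exponential of - tau gamma^-1 ln B is B^(- tau /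
    gamma). *)
Lemma dirichlet_mean_Lambda (R : realType) (gamma tau p l : R) (L M : law R) :
  0 < gamma -> 0 < p < 1 -> Lambda_law gamma p L -> dirichlet_mean_law tau L M ->
  0 < l ->
  (\int[M]_x ((1 + l * x) `^ (- tau))%:E = (PD_transform gamma tau p l)%:E)%E.
Proof.
move=> gamma0 hp HL [_ _ _ ME] l0; have B0 := PD_base_gt0 gamma hp l0.
rewrite ME// (Lambda_law_log gamma0 hp HL l0) -EFinM -EFinN /=.
rewrite /PD_transform /powR (gt_eqF B0); congr (expR _)%:E.
by rewrite mulNr mulrA.
Qed.

(** * Mixtures of bridges *)

Lemma ge0_integral_mixture (R : realType) (xi mu : law R)
    (kappa : R.-pker (measurableTypeR R) ~> (measurableTypeR R))
    (g : measurableTypeR R -> \bar R) :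
  (forall B : set (measurableTypeR R), measurable B ->
     mu B = \int[xi]_u kappa u B)%E ->
  measurable_fun setT g -> (forall x, 0 <= g x)%E ->
  (\int[mu]_x g x = \int[xi]_u \int[kappa u]_x g x)%E.
Proof.
move=> muE mg g0.
(* Seen as a constant kernel from the one-point space, [xi] composes with [kappa] into the
   mixture. *)
pose l := @kprobability _ _ unit (measurableTypeR R) R (fun=> xi)
  (@measurable_cst _ _ _ _ setT (xi : pprobability _ R)).
rewrite -(integral_kcomp l (kernel.kernel_snd kappa) tt g0 mg).
by apply: eq_measure_integral => B mB _; exact: muE.
Qed.

Lemma law01_itvcy (R : realType) (mu : law R) :
  mu `[0, 1]%classic = 1%E -> mu `[0, +oo[%classic = 1%E.
Proof.
by apply: probability1_sub => //; apply: subset_itvl; rewrite bnd_simp.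
Qed.

Lemma measurable_powR1D (R : realType) (l r : R) :
  measurable_fun [set: measurableTypeR R] (fun x => ((1 + l * x) `^ r)%:E).
Proof.
apply/measurable_EFinP; apply: (measurableT_comp (measurable_powR _)).
by apply: measurable_funD => //; exact: measurable_funM.
Qed.

Lemma stieltjes_law_unique (R : realType) (tau : R) (mu nu : law R)
    (f : R -> R) : 0 < tau ->
  mu `[0, +oo[%classic = 1%E -> nu `[0, +oo[%classic = 1%E ->
  (forall l : R, 0 < l ->
    (\int[mu]_x ((1 + l * x) `^ (- tau))%:E = (f l)%:E)%E) ->
  (forall l : R, 0 < l ->
    (\int[nu]_x ((1 + l * x) `^ (- tau))%:E = (f l)%:E)%E) ->
  same_law mu nu.
Proof.
move=> tau0 mu1 nu1 muE nuE; apply: (stieltjes_transform_unique tau0) => // l l0.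
by rewrite muE// nuE.
Qed.

Lemma mixed_bridge_transform (R : realType) (alpha beta theta p : R)
    (K xi A : law R) : 0 < alpha < 1 -> 0 < beta -> 0 < p < 1 ->
  Lambda_law beta p K -> xi_law theta K xi ->
  mixed_bridge_law alpha (alpha * theta) xi A ->
  A `[0, +oo[%classic = 1%E /\
  forall l, 0 < l -> (\int[A]_x ((1 + l * x) `^ (- (alpha * theta)))%:E =
    (PD_transform (alpha * beta) (alpha * theta) p l)%:E)%E.
Proof.
move=> /andP[a0 a1] b0 hp HK [xi1 xiM] [kappa kE AE].
pose I01 : set (measurableTypeR R) := `[0, 1]%classic.
have mI : measurable I01 by exact: measurable_itv.
have xiI : xi I01 = 1%E := xi1.
have I01E u : I01 u = (0 <= u <= 1) :> Prop by rewrite /I01/= in_itv.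
split.
  apply: law01_itvcy; apply: (etrans (AE _ mI)).
  rewrite (eq_integral_conull mI xiI (g := cst 1%E))//.
  - by rewrite integral_cst// mul1e; exact: probability_setT.
  - exact: measurable_kernel.
  - move=> u; rewrite I01E => /kE[nu [nu1 _]] kn; exact: etrans (kn _ mI) nu1.
move=> l l0.
have mg := measurable_powR1D l (- (alpha * theta)).
have g0 (x : measurableTypeR R) : (0 <= ((1 + l * x) `^ (- (alpha * theta)))%:E)%E.
  by rewrite lee_fin powR_ge0.
rewrite (ge0_integral_mixture AE mg)//.
(* Chosen so that 1 - u + u (1 + l)^alpha = 1 + m u, while (1 + m)^beta = (1 + l)^(alpha beta). *)
pose m := (1 + l) `^ alpha - 1.
have m0 : 0 < m.
  rewrite subr_gt0 -[ltLHS](pow1R alpha) gt0_ltr_powR// ?nnegrE ?ltrDl//.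
  by rewrite addr_ge0// ltW.
(* The kernel is specified on [0,1] only, so the integrands are compared there; [xi] gives this
   interval full mass. *)
rewrite (eq_integral_conull mI xiI
  (g := fun u : measurableTypeR R => ((1 + m * u) `^ (- theta))%:E)).
- rewrite (dirichlet_mean_Lambda b0 hp HK xiM m0) /PD_transform.
  have -> : 1 + m = (1 + l) `^ alpha by rewrite /m addrC subrK.
  rewrite -powRrM; congr (_ `^ (- _))%:E.
  by rewrite -mulf_div divff ?gt_eqF// mul1r.
- apply: (measurable_fun_integral_kernel (l := kappa)) => //.
  by move=> U mU; exact: measurable_kernel.
- exact: measurable_powR1D.
- move=> u; rewrite I01E => /kE[nu [_ nuE]] kn.
  rewrite (@eq_measure_integral _ _ _ _ nu); last by move=> B mB _; exact: kn.
  rewrite nuE// /PD_transform; congr (_ `^ (- _))%:E.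
    by rewrite /m; ring.
  by rewrite mulrAC divff ?gt_eqF// mul1r.
Qed.

Lemma image_law_random_mass (R : realType) (d d' : measure_display)
    (T : measurableType d) (P : probability T R) (S : measurableType d')
    (Pr : R.-pker T ~> S) (C : set S) (PC : law R) :
  image_law P (random_mass Pr C) PC -> PC `[0, +oo[%classic = 1%E.
Proof.
move=> HPC; apply: (image_law_conull _ HPC) => //.
rewrite (_ : _ @^-1` _ = setT); first exact: probability_setT.
apply/seteqP; split=> // w _; rewrite /= in_itv/= andbT /random_mass.
by rewrite fine_ge0.
Qed.

(** * Subordination *)

Lemma measurable_fubini_F d d' (T : measurableType d) (T' : measurableType d')
    (R : realType) (P : probability T' R) (f : T * T' -> \bar R) :
  measurable_fun setT f -> (forall z, 0 <= f z)%E ->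
  measurable_fun setT (fun x => \int[P]_y f (x, y))%E.
Proof. by move=> mf f0; exact: (measurable_fun_fubini_tonelli_F (m2 := P)). Qed.

Lemma ge0_integral_product d d' (T : measurableType d) (T' : measurableType d')
    (R : realType) (P : probability T R) (Q : probability T' R)
    (f : T * T' -> \bar R) :
  measurable_fun setT f -> (forall z, 0 <= f z)%E ->
  (\int[P \x Q]_z f z = \int[P]_x \int[Q]_y f (x, y))%E.
Proof. by move=> mf f0; rewrite fubini_tonelli1. Qed.

(** Tonelli applied to the two middle variables, the first staying outermost and the fourth
    innermost. It regroups two pairs (S_beta, S_alpha) into a pair of beta-stable and a pair of
    alpha-stable variables. *)
Lemma fubini_interchange d1 d2 d3 d4 (T1 : measurableType d1)
    (T2 : measurableType d2) (T3 : measurableType d3) (T4 : measurableType d4)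
    (R : realType) (m1 : probability T1 R) (m2 : probability T2 R)
    (m3 : probability T3 R) (m4 : probability T4 R)
    (k : (T1 * T2) * (T3 * T4) -> \bar R) :
  measurable_fun setT k -> (forall z, 0 <= k z)%E ->
  (\int[m1 \x m2]_z \int[m3 \x m4]_w k (z, w) =
   \int[m1 \x m3]_z \int[m2 \x m4]_w k ((z.1, w.1), (z.2, w.2)))%E.
Proof.
move=> mk k0.
pose k' (z : (T1 * T3) * (T2 * T4)) := k ((z.1.1, z.2.1), (z.1.2, z.2.2)).
have mk' : measurable_fun setT k'.
  apply: (measurableT_comp mk).
  by apply: measurable_fun_pair; apply: measurable_fun_pair => //;
    exact: measurableT_comp.
pose P34 : probability _ R := (m3 \x m4)%E.
pose P24 : probability _ R := (m2 \x m4)%E.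
have mF := measurable_fubini_F P34 mk k0.
have mF' := measurable_fubini_F P24 mk' (fun z => k0 _).
rewrite (ge0_integral_product _ _ mF); last by move=> z; exact: integral_ge0.
rewrite (ge0_integral_product _ _ mF');
  last by move=> z; apply: integral_ge0 => ? _; exact: k0.
apply: eq_integral => x _.
have mkz y : measurable_fun setT (fun w => k ((x, y), w)).
  by apply: (measurableT_comp mk); exact: measurable_pair1.
have mkz' y : measurable_fun setT (fun w => k' ((x, y), w)).
  by apply: (measurableT_comp mk'); exact: measurable_pair1.
transitivity (\int[m2]_y \int[m3]_x' \int[m4]_y' k ((x, y), (x', y')))%E.
  by apply: eq_integral => y _; rewrite (ge0_integral_product _ _ (mkz y)).
transitivity (\int[m3]_x' \int[m2]_y \int[m4]_y' k ((x, y), (x', y')))%E; last first.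
  apply: eq_integral => x' _; rewrite (ge0_integral_product _ _ (mkz' x'))//.
  by move=> w; exact: k0.
pose h (z : (T2 * T3) * T4) := k ((x, z.1.1), (z.1.2, z.2)).
have mh : measurable_fun setT h.
  apply: (measurableT_comp mk).
  by apply: measurable_fun_pair; apply: measurable_fun_pair => //;
    exact: measurableT_comp.
have mG := measurable_fubini_F m4 mh (fun z => k0 _).
by rewrite (fubini_tonelli _ mG)// => z; apply: integral_ge0 => ? _; exact: k0.
Qed.

Lemma measurable_subordination (R : realType) (r : R) :
  measurable_fun setT
    (fun z : measurableTypeR R * measurableTypeR R => z.1 `^ r * z.2 : measurableTypeR R).
Proof.
apply: measurable_funM => //.
exact: (measurableT_comp (measurable_powR _)).
Qed.

(** Given S_beta = x, the Laplace transform of x^(1/alpha) S_alpha at l is exp (- l^alpha x);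
    integrating over x evaluates the transform of S_beta at l^alpha. *)
Lemma stable_subordination (R : realType) (alpha beta : R) (sa sb s : law R) :
  0 < alpha -> stable_law alpha sa -> stable_law beta sb ->
  stable_law (alpha * beta) s ->
  image_law (sb \x sa)%E (fun z : measurableTypeR R * measurableTypeR R =>
    z.1 `^ alpha^-1 * z.2) s.
Proof.
move=> a0 [sa1 saE] [sb1 sbE] [s1 sE].
have mf := measurable_subordination alpha^-1.
have [rho rhoE] := @image_law_exists _ _ _ (sb \x sa)%E _ mf.
pose pos : set (measurableTypeR R) := `]0, +oo[%classic.
have mpos : measurable pos by exact: measurable_itv.
have posE x : pos x = (0 < x) :> Prop by rewrite /pos/= in_itv/= andbT.
have mexp (l : R) : measurable_fun [set: measurableTypeR R]
    (fun x => (expR (- (l * x)))%:E).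
  apply/measurable_EFinP; apply: measurableT_comp => //.
  by apply: measurableT_comp.
suff srho : same_law s rho.
  by split=> // B mB; rewrite -(rhoE.2 _ mB); exact: srho.
apply: laplace_transform_unique => //.
  apply: (image_law_conull mpos rhoE).
  apply: (probability1_sub _ _ _ (product_probability1 mpos mpos sb1 sa1)).
  + exact: measurableX.
  + by rewrite -[X in measurable X]setTI; exact: mf.
  + by move=> [x y] /=; rewrite !posE /= => -[x0 y0]; rewrite mulr_gt0// powR_gt0.
move=> l l0; rewrite sE// (ge0_integral_image_law rhoE (mexp l)); last first.
  by move=> x; rewrite lee_fin expR_ge0.
have mfe := measurableT_comp (mexp l) mf.
rewrite (ge0_integral_product _ _ mfe); last by move=> z /=; rewrite lee_fin expR_ge0.
have mF := measurable_fubini_F sa mfe.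
rewrite (eq_integral_conull mpos sb1
  (g := fun x : measurableTypeR R => (expR (- (l `^ alpha * x)))%:E)).
- by rewrite powRrM; exact: esym (sbE _ (powR_gt0 _ l0)).
- by apply: mF => z /=; rewrite lee_fin expR_ge0.
- exact: mexp.
- move=> x; rewrite posE => x0 /=.
  transitivity (\int[sa]_y (expR (- ((l * x `^ alpha^-1) * y)))%:E)%E.
    by apply: eq_integral => y _; rewrite mulrA.
  rewrite saE ?mulr_gt0 ?powR_gt0// powRM ?powR_ge0 ?(ltW l0)//.
  by rewrite -powRrM mulVf ?gt_eqF// powRr1 ?(ltW x0).
Qed.

Lemma powRV (R : realType) (y r : R) : 0 <= y -> y^-1 `^ r = (y `^ r)^-1.
Proof. by move=> y0; rewrite -powR_inv1// powRAC powR_inv1// powR_ge0. Qed.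

(** Both laws are unfolded to integrals over two beta-stable and two alpha-stable variables. The
    integrands agree because (c^alpha x/y)^(1/alpha) (v/w) = c (x^(1/alpha) v) / (y^(1/alpha) w),
    where numerator and denominator are (alpha beta)-stable by subordination. *)
Lemma Lambda_mixed_law_X (R : realType) (alpha beta p c : R) (X H L L' : law R) :
  0 < alpha -> 0 < p < 1 -> c = (p / (1 - p)) `^ (alpha * beta)^-1 ->
  X_law beta X -> image_law X (fun x : R => c `^ alpha * x) H ->
  Lambda_mixed_law alpha H L -> Lambda_law (alpha * beta) p L' ->
  same_law L L'.
Proof.
move=> a0 /andP[p0 p1] cE [sb stb XE] HE [Y [sa sta YE] LE] [Z [s sts ZE]].
rewrite /= -cE => L'E.
have c0 : 0 < c by rewrite cE powR_gt0// divr_gt0// subr_gt0.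
pose pos : set (measurableTypeR R) := `]0, +oo[%classic.
have mpos : measurable pos by exact: measurable_itv.
have posE x : pos x = (0 < x) :> Prop by rewrite /pos/= in_itv/= andbT.
have sE := stable_subordination a0 sta stb sts.
pose m (z : measurableTypeR R * measurableTypeR R) : measurableTypeR R :=
  z.1 `^ alpha^-1 * z.2.
move=> B mB.
pose g (x : measurableTypeR R) : \bar R := (\1_B x)%:E.
have mg : measurable_fun setT g by apply/measurable_EFinP; exact: measurable_indic.
have g0 x : (0 <= g x)%E by rewrite lee_fin.
suff : (\int[L]_x g x = \int[L']_x g x)%E by rewrite !integral_indic// !setIT.
rewrite (ge0_integral_image_law LE mg g0) (ge0_integral_image_law L'E mg g0).
have mgL' := measurableT_comp mg L'E.1.
rewrite (ge0_integral_image_law ZE mgL'); last by move=> ?; exact: g0.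
have mgZ := measurableT_comp mgL' ZE.1.
rewrite (ge0_integral_product _ _ mgZ); last by move=> ?; exact: g0.
have mFZ := measurable_fubini_F s mgZ (fun z => g0 _).
rewrite (ge0_integral_image_law sE mFZ);
  last by move=> x; apply: integral_ge0 => ? _; exact: g0.
pose psi (u v : R) : R := c * (u / v) / (1 + c * (u / v)).
have mm := measurable_subordination alpha^-1.
have mpsi : measurable_fun setT
    (fun z : (measurableTypeR R * measurableTypeR R) *
      (measurableTypeR R * measurableTypeR R) => g (psi (m z.1) (m z.2))).
  have mpair : measurable_fun setT
      (fun z : (measurableTypeR R * measurableTypeR R) *
        (measurableTypeR R * measurableTypeR R) => (m z.1, m z.2)).
    by apply: measurable_fun_pair; exact: (measurableT_comp mm).
  exact: (measurableT_comp mgZ mpair).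
transitivity (\int[sb \x sa]_z \int[sb \x sa]_w g (psi (m z) (m w)))%E; last first.
  apply: eq_integral => z _.
  have mgz : measurable_fun setT (fun v : measurableTypeR R => g (psi (m z) v)).
    exact: (measurable_fun_pair2 (m z) mgZ).
  by rewrite (ge0_integral_image_law sE mgz).
(* The right-hand side is now grouped as the left-hand side will be: beta-stable pair outside,
   alpha-stable pair inside. *)
rewrite (fubini_interchange _ _ _ _ mpsi)//.
have mgL := measurableT_comp mg LE.1.
rewrite (ge0_integral_product _ _ mgL); last by move=> ?; exact: g0.
have mFL := measurable_fubini_F Y mgL (fun z => g0 _).
rewrite (ge0_integral_image_law HE mFL);
  last by move=> x; apply: integral_ge0 => ? _; exact: g0.
have mFH := measurableT_comp mFL HE.1.
rewrite (ge0_integral_image_law XE mFH);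
  last by move=> x; apply: integral_ge0 => ? _; exact: g0.
have mFX := measurableT_comp mFH XE.1.
have mperm : measurable_fun setT
    (fun t : (measurableTypeR R * measurableTypeR R) *
      (measurableTypeR R * measurableTypeR R) =>
      g (psi (m (t.1.1, t.2.1)) (m (t.1.2, t.2.2)))).
  have mswap : measurable_fun setT
      (fun t : (measurableTypeR R * measurableTypeR R) *
        (measurableTypeR R * measurableTypeR R) =>
        ((t.1.1, t.2.1), (t.1.2, t.2.2))).
    by apply: measurable_fun_pair; apply: measurable_fun_pair => //;
      exact: measurableT_comp.
  exact: (measurableT_comp mpsi mswap).
(* Powers are taken of expressions in [x] and [y], so their laws are used for positive values of
   these, which have full mass. *)
apply: (eq_integral_conull _ (product_probability1 mpos mpos stb.1 stb.1)).
- exact: measurableX.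
- exact: mFX.
- pose P2 : probability _ R := (sa \x sa)%E.
  exact: (measurable_fubini_F P2 mperm (fun z => g0 _)).
- move=> [x y] []; rewrite /= !posE => x0 y0.
  have mgY : measurable_fun setT (fun v : measurableTypeR R =>
      g ((c `^ alpha * (x / y)) `^ alpha^-1 * v /
        ((c `^ alpha * (x / y)) `^ alpha^-1 * v + 1))).
    exact: (measurable_fun_pair2 (c `^ alpha * (x / y)) mgL).
  rewrite (ge0_integral_image_law YE mgY)//.
  apply: eq_integral => -[v w] _ /=; congr g.
  have -> : (c `^ alpha * (x / y)) `^ alpha^-1 * (v / w) =
      c * (m (x, v) / m (y, w)).
    rewrite /m /= powRM ?powR_ge0// ?divr_ge0 ?(ltW x0) ?(ltW y0)//.
    rewrite -powRrM mulfV ?gt_eqF// powRr1 ?(ltW c0)//.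
    rewrite powRM ?invr_ge0 ?(ltW x0) ?(ltW y0)// powRV ?(ltW y0)//.
    by rewrite -mulrA mulf_div.
  by rewrite /psi addrC.
Qed.

(* H is the law of R = c^alpha X_beta, K that of R/(R+1).  The constant is
   c = (p/q)^(1/(alpha beta)), the only one for which Lambda_{alpha,H} is
   Lambda_{alpha beta,p}; then R/(R+1) has law Lambda_{beta,p}. *)
Theorem proposition5p16 (R : realType) (alpha beta theta p q c : R)
    (halpha : 0 < alpha < 1) (hbeta : 0 < beta < 1) (htheta : 0 < theta)
    (hp : 0 < p < 1) (hq : q = 1 - p)
    (hc : c = (p / q) `^ (alpha * beta)^-1)
    (X H K : law R)
    (hX : X_law beta X)
    (hH : image_law X (fun x : R => c `^ alpha * x) H)
    (hK : image_law H (fun r : R => r / (r + 1)) K) :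
  [/\ (* Lambda_{alpha,H} = Lambda_{alpha beta,p} *)
      forall L L' : law R,
        Lambda_mixed_law alpha H L -> Lambda_law (alpha * beta) p L' ->
        same_law L L',
      (* xi_theta = A^{(beta,theta)}_{beta,p} = M_theta(Lambda_{beta,p}) *)
      forall xi A L M : law R,
        xi_law theta K xi ->
        bridge_law beta theta p A ->
        Lambda_law beta p L -> dirichlet_mean_law theta L M ->
        same_law xi A /\ same_law A M,
      (* the chain of identities for A^{(alpha,alpha theta)}_{alpha,xi_theta} *)
      forall (xi A A' L M PC : law R)
        (d d' : measure_display) (T : measurableType d) (P : probability T R)
        (S : measurableType d') (Pr : R.-pker T ~> S) (C : set S),
        xi_law theta K xi ->
        mixed_bridge_law alpha (alpha * theta) xi A ->
        bridge_law (alpha * beta) (alpha * theta) p A' ->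
        Lambda_law (alpha * beta) p L ->
        dirichlet_mean_law (alpha * theta) L M ->
        PD_random_measure P (alpha * beta) (alpha * theta) Pr ->
        measurable C -> (\int[P]_w Pr w C = p%:E)%E ->
        image_law P (random_mass Pr C) PC ->
        [/\ same_law A A', same_law A' M & same_law M PC],
      (* (i): theta = beta *)
      forall xi A A' : law R,
        xi_law beta K xi ->
        mixed_bridge_law alpha (alpha * beta) xi A ->
        bridge_law (alpha * beta) (alpha * beta) p A' ->
        same_law A A'
    & (* (ii): theta = 1 *)
      forall xi A A' : law R,
        xi_law 1 K xi ->
        mixed_bridge_law alpha alpha xi A ->
        bridge_law (alpha * beta) alpha p A' ->
        same_law A A'].
Proof.
subst q; have /andP[a0 a1] := halpha; have /andP[b0 b1] := hbeta.
have /andP[p0 p1] := hp.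
have pq0 : 0 <= p / (1 - p) by rewrite divr_ge0 ?subr_ge0 ?(ltW p0) ?(ltW p1).
(* With r = c^alpha X_beta, r / (r + 1) has the form defining Lambda_{beta,p}, because c^alpha = (p
   / (1 - p))^(1/beta). *)
have HK : Lambda_law beta p K.
  exists X => //=; have cE : c `^ alpha = (p / (1 - p)) `^ beta^-1.
    rewrite hc -powRrM; congr (_ `^ _).
    by field; rewrite !gt_eqF.
  rewrite -cE; split.
    rewrite (_ : (fun x => _) =
      (fun r : R => r / (r + 1)) \o (fun x : R => c `^ alpha * x)).
      exact: (measurableT_comp hK.1 hH.1).
    by apply/funext => x /=; rewrite [1 + _]addrC.
  move=> B mB.
  have mB' : measurable
      ((fun r : measurableTypeR R => r / (r + 1) : measurableTypeR R) @^-1` B).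
    by rewrite -[Y in measurable Y]setTI; exact: hK.1.
  apply: (etrans (hK.2 _ mB)); apply: (etrans (hH.2 _ mB')).
  by rewrite /pushforward; congr (X _); apply/seteqP; split => x /=; rewrite [1 + _]addrC.
have ab0 : 0 < alpha * beta by rewrite mulr_gt0.
(* A free parameter [t] serves the general chain and the two special cases t = beta and t = 1. *)
have mixed (t : R) (xi A A' : law R) : 0 < t ->
    xi_law t K xi -> mixed_bridge_law alpha (alpha * t) xi A ->
    bridge_law (alpha * beta) (alpha * t) p A' -> same_law A A'.
  move=> t0 hxi hA [A'1 A'E].
  have [A1 AE] := mixed_bridge_transform halpha b0 hp HK hxi hA.
  apply: (stieltjes_law_unique _ A1 (law01_itvcy A'1) AE A'E).
  by rewrite mulr_gt0.
split.
- by move=> L L'; exact: Lambda_mixed_law_X hX hH.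
- move=> xi A L M [xi1 xiM] [A1 AE] HL HM; have [_ _ M1 _] := HM.
  split.
    apply: (stieltjes_law_unique htheta (law01_itvcy xi1) (law01_itvcy A1) _ AE).
    by move=> l l0; exact: dirichlet_mean_Lambda HK xiM l0.
  apply: (stieltjes_law_unique htheta (law01_itvcy A1) M1 AE).
  by move=> l l0; exact: dirichlet_mean_Lambda HL HM l0.
- move=> xi A A' L M PC d d' T P S Pr C hxi hA hA' hL hM hPr mC PrC hPC.
  have at0 : 0 < alpha * theta by rewrite mulr_gt0.
  have [A'1 A'E] := hA'; have [_ _ M1 _] := hM.
  have ME l : 0 < l -> (\int[M]_x ((1 + l * x) `^ (- (alpha * theta)))%:E =
      (PD_transform (alpha * beta) (alpha * theta) p l)%:E)%E.
    exact: dirichlet_mean_Lambda hL hM.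
  split.
  + exact: mixed hxi hA hA'.
  + exact: (stieltjes_law_unique at0 (law01_itvcy A'1) M1 A'E ME).
  + apply: (stieltjes_law_unique at0 M1 (image_law_random_mass hPC) ME).
    (* Pulled back to the underlying probability space, the transform of [PC] is the one prescribed
       for the random measure at a set of mean mass p. *)
    move=> l l0; rewrite (ge0_integral_image_law hPC (measurable_powR1D _ _)).
      exact: hPr mC PrC l l0.
    by move=> x; rewrite lee_fin powR_ge0.
- by move=> xi A A'; exact: mixed.
- by move=> xi A A'; have := @mixed 1 xi A A'; rewrite mulr1; apply.
Qed.
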